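(* Let $F$ be a free group and let $R$ and $S$ be normal subgroups of $F$. Then $$F\cap (1+\mathfrak r\mathfrak f\mathfrak s)=[R'\cap S',\, R\cap S]\,[R'\cap S,\,R'\cap S]\,[R\cap S',\,R\cap S']\,W,$$ where $W$ is the subgroup of $F$ generated by all elements of the form $$[x_1,\,y]\,[x,\,y_2]^{-1}$$ for which there are an integer $m\ge 2$ and elements $x_2,y_1$ of $F$ such that $x,y\in R\cap S$, $x^m=x_1x_2$, $y^m=y_1y_2$, $x_1,y_1\in R'\cap S$, and $x_2,y_2\in R\cap S'$.
   Context: For a normal subgroup $G$ of $F$, $\mathfrak g$ denotes the two-sided ideal of the integral group ring $\mathbb Z[F]$ generated by $G-1=\{g-1 : g\in G\}$; thus $\mathfrak r,\mathfrak f,\mathfrak s$ are the ideals corresponding to $R,F,S$ (so $\mathfrak f$ is the augmentation ideal), and $\mathfrak r\mathfrak f\mathfrak s$ is their product. For a two-sided ideal $\mathfrak a$ of $\mathbb Z[F]$, $F\cap(1+\mathfrak a)=\{w\in F : w-1\in\mathfrak a\}$, a normal subgroup of $F$. $R'=[R,R]$ and $S'=[S,S]$ are the derived subgroups. Commutators are $[g,h]=g^{-1}h^{-1}gh$, and for subgroups $A,B$ of $F$, $[A,B]$ is the subgroup generated by all $[a,b]$ with $a\in A$, $b\in B$. Juxtaposition of subgroups denotes the product set. *)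

(* Defs.v *)
From HB Require Import structures.
From mathcomp Require Import all_boot all_order all_algebra.
From mathcomp Require Import finmap boolp classical_sets monalg.

Set Implicit Arguments.
Unset Strict Implicit.
Unset Printing Implicit Defensive.

Import GRing.Theory.
Local Open Scope classical_set_scope.

Section Groups.
Local Open Scope group_scope.
Variable F : groupType.
Implicit Types A B : set F.

Definition is_subgroup A : Prop :=
  [/\ A 1, forall x y, A x -> A y -> A (x * y) & forall x, A x -> A x^-1].

Definition is_normal_subgroup A : Prop :=
  is_subgroup A /\ forall x y, A x -> A (x ^ y).

Definition generated A : set F := smallest is_subgroup A.

(* [~ a, b] is a^-1 * b^-1 * a * b. *)
Definition commutator_subgroup A B : set F :=
  generated [set [~ a, b] | a in A & b in B].

Definition derived_subgroup A : set F := commutator_subgroup A A.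

Definition product_set A B : set F := [set a * b | a in A & b in B].

(* Universal property of a free basis; X may be infinite. *)
Definition is_basis (X : Type) (i : X -> F) : Prop :=
  forall (H : groupType) (f : X -> H),
    (exists phi : {multiplicative F -> H}, forall x, phi (i x) = f x) /\
    (forall phi psi : {multiplicative F -> H},
       (forall x, phi (i x) = psi (i x)) -> forall w, phi w = psi w).

Definition is_free_group : Prop :=
  exists (X : Type) (i : X -> F), is_basis i.

End Groups.

(* The integral group ring Z[F]. The multiplication of {malg int[F]} in the library requires an index monoid
   in which only 1 is invertible, hence this alias with the convolution product
   of a group. *)
Definition group_ring (F : groupType) : Type := {malg int[F]}.

HB.instance Definition _ (F : groupType) := GRing.Zmodule.on (group_ring F).

Section GroupRing.
Local Open Scope fset_scope.
Local Open Scope ring_scope.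
Variable F : groupType.
Implicit Types g : group_ring F.

Definition group_elt (w : F) : group_ring F := << w >>.

Local Notation "g1 *M_[ k1 , k2 ] g2" :=
  (<< g1@_k1 * g2@_k2 *g (k1 * k2)%g >> : group_ring F)
  (at level 40, no associativity).

Definition gr_one : group_ring F := group_elt 1%g.

Definition gr_mul g1 g2 : group_ring F :=
  \sum_(k1 <- msupp g1) \sum_(k2 <- msupp g2) g1 *M_[k1, k2] g2.

Fact gr_mulr g1 g2 : gr_mul g1 g2 =
  \sum_(k2 <- msupp g2) \sum_(k1 <- msupp g1) g1 *M_[k1, k2] g2.
Proof. by rewrite /gr_mul exchange_big. Qed.

Fact gr_mullw (d1 d2 : {fset F}) g1 g2 :
  msupp g1 `<=` d1 -> msupp g2 `<=` d2 ->
  gr_mul g1 g2 = \sum_(k1 <- d1) \sum_(k2 <- d2) g1 *M_[k1, k2] g2.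
Proof.
move=> le_d1 le_d2; rewrite /gr_mul (big_fset_incl _ le_d1) /=.
  apply/eq_bigr=> k1 _; apply/big_fset_incl => // k _ /mcoeff_outdom ->.
  by rewrite mulr0 monalgU0.
move=> k _ /mcoeff_outdom g1k.
by rewrite big1 => // k' _; rewrite g1k mul0r monalgU0.
Qed.

Fact gr_mulrw (d1 d2 : {fset F}) g1 g2 :
  msupp g1 `<=` d1 -> msupp g2 `<=` d2 ->
  gr_mul g1 g2 = \sum_(k2 <- d2) \sum_(k1 <- d1) g1 *M_[k1, k2] g2.
Proof. by move=> le_d1 le_d2; rewrite (gr_mullw le_d1 le_d2) exchange_big. Qed.

Fact gr_mul0g : left_zero 0 gr_mul.
Proof. by move=> g; rewrite /gr_mul msupp0 big_seq_fset0. Qed.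

Fact gr_mulg0 : right_zero 0 gr_mul.
Proof. by move=> g; rewrite gr_mulr msupp0 big_seq_fset0. Qed.

Fact gr_mulUg c k g :
  gr_mul << c *g k >> g =
  \sum_(k' <- msupp g) << c * g@_k' *g (k * k')%g >>.
Proof.
rewrite (gr_mullw msuppU_le (fsubset_refl _)) big_seq_fset1.
by apply/eq_bigr => k' _; rewrite mcoeffUU.
Qed.

Fact gr_mulgU c k g :
  gr_mul g << c *g k >> =
  \sum_(k' <- msupp g) << g@_k' * c *g (k' * k)%g >>.
Proof.
rewrite (gr_mulrw (fsubset_refl _) msuppU_le) big_seq_fset1.
by apply/eq_bigr=> k' _; rewrite mcoeffUU.
Qed.

Fact gr_mulUU c1 c2 k1 k2 :
  gr_mul << c1 *g k1 >> << c2 *g k2 >> = << c1 * c2 *g (k1 * k2)%g >>.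
Proof. by rewrite (gr_mulrw msuppU_le msuppU_le) !big_seq_fset1 !mcoeffUU. Qed.

Fact gr_mulEl g1 g2 :
  gr_mul g1 g2 = \sum_(k1 <- msupp g1) gr_mul << g1@_k1 *g k1 >> g2.
Proof. by apply/eq_bigr=> k _; rewrite gr_mulUg. Qed.

Fact gr_mulEr g1 g2 :
  gr_mul g1 g2 = \sum_(k2 <- msupp g2) gr_mul g1 << g2@_k2 *g k2 >>.
Proof. by rewrite gr_mulr; apply/eq_bigr=> k _; rewrite gr_mulgU. Qed.

Fact gr_mul1g : left_id gr_one gr_mul.
Proof.
move=> g; rewrite gr_mulUg [RHS]monalgE.
by apply/eq_bigr=> k _; rewrite mul1r mul1g.
Qed.

Fact gr_mulg1 : right_id gr_one gr_mul.
Proof.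
move=> g; rewrite gr_mulgU [RHS]monalgE.
by apply/eq_bigr=> k _; rewrite mulr1 mulg1.
Qed.

Fact gr_mulDl : left_distributive gr_mul +%R.
Proof.
move=> g1 g2 g.
rewrite [in RHS](gr_mullw (fsubsetUl _ (msupp g2)) (fsubset_refl _)).
rewrite [in RHS](gr_mullw (fsubsetUr (msupp g1) _) (fsubset_refl _)).
rewrite (gr_mullw (msuppD_le _ _) (fsubset_refl _)).
rewrite -big_split /=; apply/eq_bigr=> k1 _.
rewrite -big_split /=; apply/eq_bigr=> k2 _.
by rewrite mcoeffD mulrDl monalgUD.
Qed.

Fact gr_mulDr : right_distributive gr_mul +%R.
Proof.
move=> g g1 g2.
rewrite [in RHS](gr_mulrw (fsubset_refl _) (fsubsetUl _ (msupp g2))).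
rewrite [in RHS](gr_mulrw (fsubset_refl _) (fsubsetUr (msupp g1) _)).
rewrite (gr_mulrw (fsubset_refl _) (msuppD_le _ _)).
rewrite -big_split /=; apply/eq_bigr => k1 _.
rewrite -big_split /=; apply/eq_bigr => k2 _.
by rewrite mcoeffD mulrDr monalgUD.
Qed.

Fact gr_mulA : associative gr_mul.
Proof.
move=> g1 g2 g3.
rewrite [RHS](big_morph (gr_mul^~ _) (fun _ _ => gr_mulDl _ _ _) (gr_mul0g _)).
rewrite gr_mulEl; apply/eq_bigr=> k1 _.
rewrite [LHS](big_morph (gr_mul _) (fun _ _ => gr_mulDr _ _ _) (gr_mulg0 _)).
rewrite [RHS](big_morph (gr_mul^~ _) (fun _ _ => gr_mulDl _ _ _) (gr_mul0g _)).
apply/eq_bigr=> k2 _.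
rewrite [LHS](big_morph (gr_mul _) (fun _ _ => gr_mulDr _ _ _) (gr_mulg0 _)).
by rewrite gr_mulEr; apply/eq_bigr=> k3 _; rewrite !gr_mulUU mulrA mulgA.
Qed.

Fact gr_one_neq0 : gr_one != 0.
Proof. by apply/eqP/malgP=> /(_ 1%g) /eqP; rewrite mcoeffUU mcoeff0 oner_eq0. Qed.

HB.instance Definition _ := GRing.Zmodule_isNzRing.Build (group_ring F)
  gr_mulA gr_mul1g gr_mulg1 gr_mulDl gr_mulDr gr_one_neq0.

Lemma group_elt1 : group_elt 1%g = 1.
Proof. by []. Qed.

Lemma group_eltM (u v : F) : group_elt (u * v)%g = group_elt u * group_elt v.
Proof. by rewrite -[RHS]/(gr_mul _ _) gr_mulUU mulr1. Qed.

End GroupRing.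

Section Ideals.
Local Open Scope ring_scope.
Variable T : nzRingType.
Implicit Types I J : set T.

Definition is_additive_subgroup I : Prop :=
  I 0 /\ forall a b, I a -> I b -> I (a - b).

Definition is_ideal I : Prop :=
  [/\ is_additive_subgroup I, forall c a, I a -> I (c * a)
    & forall c a, I a -> I (a * c)].

Definition ideal_generated (A : set T) : set T := smallest is_ideal A.

Definition ideal_mul I J : set T :=
  smallest is_additive_subgroup [set a * b | a in I & b in J].

End Ideals.

Section FreeGroupRing.
Local Open Scope ring_scope.
Variable F : groupType.

(* The two-sided ideal of Z[F] generated by G - 1. *)
Definition relative_ideal (G : set F) : set (group_ring F) :=
  ideal_generated [set group_elt g - 1 | g in G].

(* The intersection of F with 1 + I. *)
Definition ideal_subgroup (I : set (group_ring F)) : set F :=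
  [set w | I (group_elt w - 1)].

End FreeGroupRing.

Section W.
Local Open Scope group_scope.
Variable F : groupType.

Definition W_generators (R S : set F) : set F :=
  [set z | exists x y x1 x2 y1 y2 : F, exists m : nat,
     [/\ (2 <= m)%N,
         [/\ (R `&` S) x & (R `&` S) y],
         [/\ x ^+ m = x1 * x2 & y ^+ m = y1 * y2],
         [/\ (derived_subgroup R `&` S) x1, (derived_subgroup R `&` S) y1,
             (R `&` derived_subgroup S) x2 & (R `&` derived_subgroup S) y2]
       & z = [~ x1, y] * [~ x, y2]^-1]].

Definition W (R S : set F) : set F := generated (W_generators R S).

End W.

(* Main.v *)
(* Write D = R \cap S. A function Phi : F -> N extends additively to Z[F], and the extension kills
   rfs as soon as Phi(xuy) - Phi(xu) - Phi(uy) + Phi(u) does not depend on u, for x in R and y in S.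
   Indicators of R and S, together with a function built from transversals of D in R and in S and
   with values in D/D', show that F \cap (1 + rfs) lies in D'. Every function on the edges of the
   Cayley tree of F is the coboundary of a function on F; hence each pair of homomorphisms
   a : R -> Z, b : S -> Z has a Phi for which the above expression is a(x) b(y). If
   w = \prod_i [x_i, y_i] with x_i, y_i in D is in 1 + rfs, these Phi give
   sum_i (a(x_i) b(y_i) - a(y_i) b(x_i)) = 0. Such homomorphisms separate the points of R/R' and
   S/S', so sum_i x_i /\ y_i, over D/D', is killed by x /\ y |-> x (x) y - y (x) x with values in
   R/R' (x) S/S'. Let K1 and K2 be the images of R' \cap S and R \cap S' in D/D'. A basis of a
   finitely generated subgroup modulo K2, stacked with respect to K1 + K2, shows that the kernel of
   this map is generated by (K1 \cap K2) /\ D/D', K1 /\ K1, K2 /\ K2 and the elements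
   x1 /\ y - x /\ y2 with m x = x1 + x2 and m y = y1 + y2. *)
From HB Require Import structures.
Require Import Defs.
From mathcomp Require Import all_boot all_order all_algebra.
From mathcomp Require Import finmap boolp classical_sets monalg ring zify.

Set Implicit Arguments.
Unset Strict Implicit.
Unset Printing Implicit Defensive.

Import Order.TTheory GRing.Theory Num.Theory.
Local Open Scope classical_set_scope.

(** * Stacked bases of lattices *)

Local Open Scope ring_scope.

(** Convertible with [is_additive_subgroup] on a ring, so the closure lemmas below also serve for
    ideals. *)
Definition zmod_subgroup (A : zmodType) (H : set A) : Prop :=
  H 0 /\ forall a b, H a -> H b -> H (a - b).

Section ZmodSubgroup.
Variables (A : zmodType) (H : set A).
Hypothesis sH : zmod_subgroup H.

Lemma zsub0 : H 0. Proof. by case: sH. Qed.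

Lemma zsubB a b : H a -> H b -> H (a - b). Proof. by case: sH => _; apply. Qed.

Lemma zsubN a : H a -> H (- a).
Proof. by move=> Ha; rewrite -sub0r; apply: zsubB => //; apply: zsub0. Qed.

Lemma zsubD a b : H a -> H b -> H (a + b).
Proof. by move=> Ha Hb; rewrite -[b]opprK; apply: zsubB => //; apply: zsubN. Qed.

Lemma zsubMz a m : H a -> H (a *~ m).
Proof.
move=> Ha; have HM n : H (a *+ n).
  by elim: n => [|n IH]; rewrite ?mulrS; [exact: zsub0|exact: zsubD].
by case: m => m; rewrite ?NegzE ?mulrNz -pmulrn; [|apply: zsubN]; apply: HM.
Qed.

Lemma zsub_sum (I : Type) (r : seq I) (P : pred I) (E : I -> A) :
  (forall i, P i -> H (E i)) -> H (\sum_(i <- r | P i) E i).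
Proof. by move=> HE; elim/big_ind: _ => //; [apply: zsub0 | apply: zsubD]. Qed.

End ZmodSubgroup.

Lemma int_ideal_principal (H : set int) :
  zmod_subgroup H -> exists d, forall x, H x <-> (d %| x)%Z.
Proof.
move=> sH; have [[x [Hx x0]]|noH] := pselect (exists x, H x /\ x != 0); last first.
  exists 0 => x; rewrite dvd0z; split=> [Hx|/eqP ->]; last exact: zsub0.
  by apply/negP=> /negP x0; apply: noH; exists x.
have ex : exists n : nat, (0 < n)%N && `[< H n%:Z >].
  exists `|x|%N; rewrite absz_gt0 x0; apply/asboolP.
  by case: (ger0P x) => xs; [rewrite gez0_abs | rewrite ltz0_abs]; rewrite ?(ltW xs) //; apply: zsubN.
case: (ex_minnP ex) => d /andP[d0 /asboolP Hd] mind.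
exists d%:Z => y; split=> [Hy|/dvdzP[q ->]]; last first.
  by rewrite -[q * _]mulrzz mulrzz mulrC -mulrzz; apply: zsubMz.
apply/dvdz_mod0P; apply: contrapT => /eqP r0.
have Hr : H (y %% d)%Z.
  have -> : (y %% d)%Z = y - (y %/ d)%Z * d by have := divz_eq y d; lia.
  apply: zsubB => //.
  by rewrite mulrC -mulrzz; apply: zsubMz.
have r_ge : 0 <= (y %% d)%Z by apply: modz_ge0; lia.
have r_lt : (y %% d)%Z < d by apply: ltz_pmod; lia.
have := mind `|(y %% d)%Z|%N; rewrite absz_gt0 r0 gez0_abs //=.
by move=> /(_ (asboolT Hr)); lia.
Qed.

(** Induction on the rank. The first coordinates of elements of [H] are the multiples of some [d];
    [h] in [H] attains [d], the rows of [N] generate the elements with first coordinate 0, and [M]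
    stacks the two. Zero rows are allowed, which keeps [M] square. *)
Lemma int_lattice_fg n (H : set 'rV[int]_n) : zmod_subgroup H ->
  exists M : 'M[int]_n, forall v, H v <-> exists c : 'rV_n, v = c *m M.
Proof.
elim: n H => [|n IH] H sH.
  exists 0 => v; rewrite [v]thinmx0; split=> _; first by exists 0; rewrite mul0mx.
  exact: zsub0.
rewrite -[n.+1]/(1 + n)%N in H sH *.
have [d dP] : exists d, forall x, (exists v : 'rV_(1 + n), H v /\ v 0 0 = x) <-> (d %| x)%Z.
  apply: int_ideal_principal; split=> [|a b [v [Hv <-]] [w [Hw <-]]].
    by exists 0; rewrite mxE; split=> //; apply: zsub0.
  by exists (v - w); rewrite !mxE; split=> //; apply: zsubB.
have [h [Hh h0]] := (dP d).2 (dvdzz d).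
have [N NP] : exists N : 'M[int]_n, forall v,
    H (row_mx (0 : 'rV_1) v : 'rV_(1 + n)) <-> exists c : 'rV_n, v = c *m N.
  apply: (IH (fun v => H (row_mx (0 : 'rV_1) v : 'rV_(1 + n)))).
  split=> [|a b Ha Hb]; first by rewrite row_mx0; apply: zsub0.
  suff -> : row_mx 0 (a - b) = row_mx 0 a - row_mx 0 b :> 'rV_(1 + n) by apply: zsubB.
  by rewrite opp_row_mx add_row_mx oppr0 addr0.
pose M : 'M[int]_(1 + n) := col_mx h (row_mx 0 N).
exists M => v; split=> [Hv|[c ->]].
  have /dvdzP[x v0] : (d %| (v 0 0)%R)%Z by apply/dP; exists v.
  pose w : 'rV_(1 + n) := v - h *~ x.
  have w0 : w = row_mx 0 (rsubmx w).
    rewrite -[LHS]hsubmxK; congr row_mx; apply/matrixP=> i j.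
    rewrite !ord1 !mxE -scaler_int !mxE (_ : lshift n ord0 = 0); last exact/val_inj.
    by rewrite v0 h0 intz subrr.
  have /NP[c wE] : H (row_mx 0 (rsubmx w) : 'rV_(1 + n)).
    by rewrite -w0; apply: zsubB => //; apply: zsubMz.
  exists (row_mx x%:M c); rewrite /M mul_row_col mul_mx_row -wE mulmx0 -w0.
  by rewrite mul_scalar_mx /w -scaler_int intz addrC subrK.
rewrite /M -[c]hsubmxK mul_row_col [lsubmx c]mx11_scalar mul_scalar_mx mul_mx_row mulmx0.
apply: zsubD => //; last by apply/NP; eexists.
by rewrite -[_ 0 0]intz scaler_int; apply: zsubMz.
Qed.

(** In the Smith form of the generating matrix the left factor [L] only changes the generators, so
    [H] is spanned by the rows of [P] multiplied by the [d i]. When [d i] is 0 the coordinate must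
    vanish. *)
Lemma int_stacked_basis n (H : set 'rV[int]_n) : zmod_subgroup H ->
  exists P : 'M[int]_n, exists d : 'I_n -> int, P \in unitmx /\
    forall v, H (v *m P) <-> forall i, (d i %| (v 0 i)%R)%Z.
Proof.
move=> /int_lattice_fg[M HM].
have [L uL [P uP [d _ ME]]] := int_Smith_normal_form M.
exists P; exists (fun i : 'I_n => d`_i); split=> // v; rewrite HM.
have diagE (c : 'rV[int]_n) i :
    (c *m \matrix_(i, j) (d`_i *+ (i == j :> nat)) : 'rV_n) 0 i = c 0 i * d`_i.
  rewrite mxE (bigD1 i) //= mxE eqxx mulr1n big1 ?addr0 // => j ji.
  by rewrite mxE -[_ == _ :> nat]/(j == i) (negbTE ji) mulr0.
split=> [[c]|dv].
  rewrite ME !mulmxA => /(can_inj (mulmxK uP)) -> i.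
  by rewrite diagE; apply: dvdz_mull.
exists (\row_i ((v 0 i)%R %/ d`_i)%Z *m invmx L).
rewrite ME !mulmxA mulmxKV //; congr (_ *m _); apply/rowP=> i.
by rewrite diagE mxE divzK.
Qed.

Definition lincomb (A : zmodType) n (b : 'I_n -> A) (c : 'rV[int]_n) : A :=
  \sum_i b i *~ c 0 i.

Section LinComb.
Variable A : zmodType.

Lemma lincombB n (b : 'I_n -> A) c1 c2 :
  lincomb b (c1 - c2) = lincomb b c1 - lincomb b c2.
Proof.
by rewrite /lincomb -sumrB; apply: eq_bigr => i _; rewrite !mxE mulrzBr.
Qed.

Lemma lincomb0 n (b : 'I_n -> A) : lincomb b 0 = 0.
Proof. by rewrite /lincomb big1 // => i _; rewrite mxE mulr0z. Qed.

Lemma lincomb_mul m n (b : 'I_n -> A) (M : 'M_(m, n)) c :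
  lincomb b (c *m M) = lincomb (fun i => lincomb b (row i M)) c.
Proof.
rewrite /lincomb.
under eq_bigr => i _ do rewrite mxE mulrz_sumr.
rewrite exchange_big; apply: eq_bigr => j _; rewrite mulrz_suml.
by apply: eq_bigr => i _; rewrite mxE mulrC mulrzA.
Qed.

Lemma lincomb_delta n (b : 'I_n -> A) i d : lincomb b (d *: delta_mx 0 i) = b i *~ d.
Proof.
rewrite /lincomb (bigD1 i) //= !mxE !eqxx mulr1 big1 ?addr0 // => j ji.
by rewrite !mxE (negbTE ji) mulr0 mulr0z.
Qed.

(** Since A/K is torsion-free, [b] spans a free group modulo [K], and [q] is a basis of it stacked
    with respect to [H]. Two stacked bases are taken: one for the relations of [b] modulo [K], one
    for the preimage of [H] in the surviving coordinates. *)
Lemma stacked_basis_mod n (b : 'I_n -> A) (K H : set A) :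
  zmod_subgroup K -> zmod_subgroup H -> K `<=` H ->
  (forall a m, m != 0 -> K (a *~ m) -> K a) ->
  exists l, exists q : 'I_l -> A, exists d : 'I_l -> int,
  [/\ forall i, exists c, K (b i - lincomb q c),
      forall c, K (lincomb q c) -> c = 0,
      forall t, H (q t *~ d t)
    & forall c, H (lincomb q c) -> forall t, (d t %| (c 0 t)%R)%Z].
Proof.
move=> sK sH KH pure.
have [P [d [uP PK]]] : exists P : 'M[int]_n, exists d : 'I_n -> int, P \in unitmx /\
    forall v, K (lincomb b (v *m P)) <-> forall i, (d i %| (v 0 i)%R)%Z.
  apply: (int_stacked_basis (H := fun v => K (lincomb b v))).
  split=> [|u v]; first by rewrite lincomb0; apply: zsub0.
  by rewrite lincombB; apply: zsubB.
pose p i := lincomb b (row i P).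
have pK v : K (lincomb p v) <-> forall i, (d i %| (v 0 i)%R)%Z by rewrite -PK lincomb_mul.
(* Purity puts every new generator with a nonzero divisor into [K]; those with divisor 0 remain
   independent modulo [K]. *)
have pK0 i : d i != 0 -> K (p i).
  move=> di; apply: (pure _ (d i)) => //; rewrite -(lincomb_delta p); apply/pK => j.
  by rewrite !mxE eqxx; case: eqP => [->|_]; rewrite ?mulr1 ?mulr0.
pose l := #|[pred i | d i == 0]|.
pose E : 'M[int]_(l, n) := \matrix_(t, i) (enum_val t == i)%:R.
pose r (t : 'I_l) := p (enum_val t).
have rE c : lincomb r c = lincomb p (c *m E).
  rewrite lincomb_mul; apply: eq_bigr => t _; congr (_ *~ _).
  rewrite /r -[LHS]mulr1z -lincomb_delta scale1r; congr lincomb.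
  by apply/rowP=> i; rewrite !mxE eqxx /= eq_sym.
have rfree c : K (lincomb r c) -> c = 0.
  rewrite rE => /pK dc; apply/rowP=> t; have := dc (enum_val t).
  have := enum_valP t; rewrite inE => /eqP ->; rewrite dvd0z => /eqP cE0.
  rewrite [RHS]mxE -[RHS]cE0 mxE (bigD1 t) //= mxE eqxx mulr1 big1 ?addr0 // => u ut.
  by rewrite mxE (inj_eq enum_val_inj) (negbTE ut) mulr0.
have rgen v : exists c, K (lincomb p v - lincomb r c).
  exists (\row_t v 0 (enum_val t)).
  rewrite {1}/lincomb (bigID (mem [pred i | d i == 0])) /= big_enum_val addrC.
  rewrite /lincomb; under [X in _ - X]eq_bigr => t _ do rewrite mxE.
  rewrite addrK; apply: zsub_sum => // i; rewrite inE => di.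
  by apply: zsubMz => //; apply: pK0.
(* The second base change, by [Q], adapts the independent generators [r] to [H]. *)
have [Q [e [uQ QH]]] : exists Q : 'M[int]_l, exists e : 'I_l -> int, Q \in unitmx /\
    forall v, H (lincomb r (v *m Q)) <-> forall t, (e t %| (v 0 t)%R)%Z.
  apply: (int_stacked_basis (H := fun v => H (lincomb r v))).
  split=> [|u v]; first by rewrite lincomb0; apply: zsub0.
  by rewrite lincombB; apply: zsubB.
exists l, (fun t => lincomb r (row t Q)), e; split.
- move=> i; have [c Kc] := rgen (row i (invmx P)).
  exists (c *m invmx Q); rewrite -lincomb_mul mulmxKV //.
  move: Kc; rewrite -lincomb_mul -row_mul mulVmx // row1.
  by rewrite -[delta_mx _ _]scale1r lincomb_delta.
- move=> c; rewrite -lincomb_mul => /rfree cQ.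
  by rewrite -[c](mulmxK uQ) cQ mul0mx.
- move=> t; rewrite -(lincomb_delta (fun t => lincomb r (row t Q))) -lincomb_mul; apply/QH => u.
  by rewrite !mxE eqxx; case: eqP => [->|_]; rewrite ?mulr1 ?mulr0.
- by move=> c; rewrite -lincomb_mul => /QH.
Qed.
End LinComb.

(** * Alternating forms *)

Section MorphD.
Variables (A B : zmodType) (f : A -> B).
Hypothesis fD : {morph f : x y / x + y}.

Lemma morphD0 : f 0 = 0.
Proof. by apply: (addrI (f 0)); rewrite -fD !addr0. Qed.

Lemma morphDN : {morph f : x / - x}.
Proof. by move=> x; apply: (addrI (f x)); rewrite -fD !subrr morphD0. Qed.

Lemma morphDB : {morph f : x y / x - y}.
Proof. by move=> x y; rewrite fD morphDN. Qed.

Lemma morphD_sum (I : Type) (r : seq I) (P : pred I) (E : I -> A) :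
  f (\sum_(i <- r | P i) E i) = \sum_(i <- r | P i) f (E i).
Proof. exact: (big_morph f fD morphD0). Qed.

Lemma morphDMn n : {morph f : x / x *+ n}.
Proof. by move=> x; elim: n => [|n IH]; rewrite ?mulr0n ?morphD0 // !mulrS fD IH. Qed.

Lemma morphDMz m : {morph f : x / x *~ m}.
Proof.
move=> x; case: m => m; first by rewrite -!pmulrn morphDMn.
by rewrite NegzE !mulrNz -!pmulrn morphDN morphDMn.
Qed.

Lemma morphD_lincomb n (b : 'I_n -> A) c :
  f (lincomb b c) = \sum_i f (b i) *~ c 0 i.
Proof. by rewrite morphD_sum; apply: eq_bigr => i _; rewrite morphDMz. Qed.

End MorphD.

(** The induction peels off the first row together with the first column. The diagonal is assumed
    zero because [A] may have 2-torsion. *)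
Lemma sum_antisym (A : zmodType) n (T : 'I_n -> 'I_n -> A) :
  (forall i, T i i = 0) -> (forall i j, T i j + T j i = 0) ->
  \sum_i \sum_j T i j = 0.
Proof.
move=> T0 Ta; elim: n => [|n IH] in T T0 Ta *; first by rewrite big_ord0.
rewrite big_ord_recl big_ord_recl T0 add0r.
under [X in _ + X]eq_bigr => i _ do rewrite big_ord_recl.
rewrite big_split /= IH // addr0 -big_split big1 // => i _; exact: Ta.
Qed.

Section AlternatingForm.
Variables (A E : zmodType) (FA FB : set (A -> int)).
Hypothesis FAD : forall f, FA f -> {morph f : x y / x + y}.
Hypothesis FBD : forall f, FB f -> {morph f : x y / x + y}.
Variables K1 K2 : set A.
Hypothesis K1E : forall a, K1 a <-> forall f, FA f -> f a = 0.
Hypothesis K2E : forall a, K2 a <-> forall f, FB f -> f a = 0.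
Variable w : A -> A -> E.
Hypothesis wDl : forall b, {morph w^~ b : x y / x + y}.
Hypothesis wDr : forall a, {morph w a : x y / x + y}.
Hypothesis waa : forall a, w a a = 0.
Hypothesis w12 : forall a b, K1 a -> K2 a -> w a b = 0.
Hypothesis w11 : forall a b, K1 a -> K1 b -> w a b = 0.
Hypothesis w22 : forall a b, K2 a -> K2 b -> w a b = 0.
Hypothesis wW : forall (m : nat) a b a1 a2 b1 b2, (2 <= m)%N ->
  K1 a1 -> K2 a2 -> K1 b1 -> K2 b2 ->
  a *+ m = a1 + a2 -> b *+ m = b1 + b2 -> w a1 b = w a b2.

Let sK1 : zmod_subgroup K1.
Proof.
split=> [|a b /K1E Ka /K1E Kb]; apply/K1E => f Ff; first exact/morphD0/FAD.
by rewrite (morphDB (FAD Ff)) Ka ?Kb ?subrr.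
Qed.

Let sK2 : zmod_subgroup K2.
Proof.
split=> [|a b /K2E Ka /K2E Kb]; apply/K2E => f Ff; first exact/morphD0/FBD.
by rewrite (morphDB (FBD Ff)) Ka ?Kb ?subrr.
Qed.

Let w_anti a b : w a b = - w b a.
Proof.
apply/eqP; rewrite -addr_eq0; have := waa (a + b).
by rewrite wDl !wDr !waa add0r addr0 => ->.
Qed.

(** Extends [wW] to all integers. For m = 0 both [a1] and [b2] lie in K1 and K2, so both sides
    vanish; for m = 1 both sides equal [w a1 b2]; for negative m all four summands change sign. *)
Let wW_int (m : int) a b a1 a2 b1 b2 :
  K1 a1 -> K2 a2 -> K1 b1 -> K2 b2 ->
  a *~ m = a1 + a2 -> b *~ m = b1 + b2 -> w a1 b = w a b2.
Proof.
have pos (n : nat) a1' a2' b1' b2' : K1 a1' -> K2 a2' -> K1 b1' -> K2 b2' ->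
    a *+ n = a1' + a2' -> b *+ n = b1' + b2' -> w a1' b = w a b2'.
  case: n => [|[|n]] Ha1 Ha2 Hb1 Hb2; last exact: wW.
    rewrite !mulr0n => /esym/addr0_eq aE /esym/addr0_eq bE.
    have Ka1 : K2 a1' by rewrite -[a1']opprK aE; exact: zsubN.
    have Kb2 : K1 b2' by rewrite -bE; exact: zsubN.
    by rewrite w12 // w_anti w12 // oppr0.
  rewrite !mulr1n => -> ->.
  by rewrite wDr w11 // add0r wDl (w22 Ha2) // addr0.
case: m => m Ha1 Ha2 Hb1 Hb2; first by rewrite -!pmulrn; apply: pos.
rewrite NegzE !mulrNz -!pmulrn => /(canRL opprK) aE /(canRL opprK) bE.
rewrite !opprD in aE bE.
have := pos m.+1 _ _ _ _ (zsubN sK1 Ha1) (zsubN sK2 Ha2) (zsubN sK1 Hb1) (zsubN sK2 Hb2) aE bE.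
by rewrite (morphDN (wDl b)) (morphDN (wDr a)) => /oppr_inj.
Qed.

(** The hypothesis says, tested by integer functionals, that the sum of the x_i /\ y_i is killed by
    x /\ y |-> x (x) y - y (x) x with values in A/K1 (x) A/K2. Coordinates modulo K2 in a basis
    stacked for K1 + K2 turn this into memberships and divisibilities, after which [w] of the sum
    becomes an antisymmetric double sum. *)
Lemma alternating_vanish n (x y : 'I_n -> A) :
  (forall f g, FA f -> FB g ->
     \sum_i (f (x i) * g (y i) - f (y i) * g (x i)) = 0) ->
  \sum_i w (x i) (y i) = 0.
Proof.
move=> xy0.
pose H : set A := [set a | exists u v, [/\ K1 u, K2 v & a = u + v]].
have sH : zmod_subgroup H.
  split=> [|_ _ [u [v [Ku Kv ->]]] [u' [v' [Ku' Kv' ->]]]].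
    by exists 0, 0; rewrite addr0; split=> //; apply: zsub0.
  exists (u - u'), (v - v'); split; [exact: zsubB..|].
  by rewrite opprD addrACA.
have K2H : K2 `<=` H by move=> a Ka; exists 0, a; rewrite add0r; split=> //; apply: zsub0.
have pure a m : m != 0 -> K2 (a *~ m) -> K2 a.
  move=> m0 /K2E Ka; apply/K2E => f Ff; have := Ka f Ff; rewrite (morphDMz (FBD Ff)) -mulrzr intz => /eqP.
  by rewrite mulf_eq0 (negbTE m0) orbF => /eqP.
pose b (i : 'I_(n + n)) := match split i with inl i => x i | inr i => y i end.
have [l [q [d [gen free Hd dH]]]] := stacked_basis_mod b sK2 sH K2H pure.
have genx i : exists c, K2 (x i - lincomb q c).
  by have := gen (unsplit (inl i)); rewrite /b unsplitK.
have geny i : exists c, K2 (y i - lincomb q c).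
  by have := gen (unsplit (inr i)); rewrite /b unsplitK.
have [X XK] := boolp.choice genx.
have [Y YK] := boolp.choice geny.
have [k xE] : {k : 'I_n -> A | forall i, x i = k i + lincomb q (X i)}.
  by exists (fun i => x i - lincomb q (X i)) => i; rewrite subrK.
have [h yE] : {h : 'I_n -> A | forall i, y i = h i + lincomb q (Y i)}.
  by exists (fun i => y i - lincomb q (Y i)) => i; rewrite subrK.
have kK i : K2 (k i) by have := XK i; rewrite xE addrK.
have hK i : K2 (h i) by have := YK i; rewrite yE addrK.
(* [Z t] is the contraction of the sum of the x_i /\ y_i with the t-th coordinate modulo K2. Its
   component in K2 is [kk t], and its coordinates [c t] are the antisymmetrisation of the matrix
   [C]. *)
pose C s t := \sum_i X i 0 s * Y i 0 t.
pose kk t := \sum_i (k i *~ Y i 0 t - h i *~ X i 0 t).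
pose Z t := \sum_i (x i *~ Y i 0 t - y i *~ X i 0 t).
pose c t : 'rV_l := \row_s (C s t - C t s).
have ZE t : Z t = kk t + lincomb q (c t).
  rewrite /Z /kk /lincomb; under [X in _ + X]eq_bigr => s _.
    rewrite mxE /C -sumrB mulrz_sumr.
    under eq_bigr => i _ do rewrite mulrzBr [X in _ - _ *~ X]mulrC !mulrzA.
    over.
  rewrite exchange_big -big_split; apply: eq_bigr => i _ /=.
  rewrite sumrB -!mulrz_suml xE yE !mulrzDl opprD addrACA; congr (_ + (_ - _)).
have wE : \sum_i w (x i) (y i) =
    \sum_t w (kk t) (q t) + \sum_s \sum_t w (q s) (q t) *~ C s t.
  transitivity (\sum_i (\sum_t (w (k i) (q t) *~ Y i 0 t - w (h i) (q t) *~ X i 0 t) +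
      \sum_s \sum_t w (q s) (q t) *~ (X i 0 s * Y i 0 t))).
    apply: eq_bigr => i _; rewrite xE yE wDl !wDr [w (k i) (h i)]w22 // add0r addrA.
    congr (_ + _); last first.
      rewrite (morphD_lincomb (wDl _)); apply: eq_bigr => s _.
      rewrite (morphD_lincomb (wDr _)) mulrz_suml; apply: eq_bigr => t _.
      by rewrite mulrC mulrzA.
    by rewrite [X in _ + X]w_anti !(morphD_lincomb (wDr _)) sumrB.
  rewrite big_split; congr (_ + _) => /=.
    rewrite exchange_big; apply: eq_bigr => t _.
    rewrite /kk (morphD_sum (wDl _)); apply: eq_bigr => i _.
    by rewrite (morphDB (wDl (q t))) !(morphDMz (wDl (q t))).
  rewrite exchange_big; apply: eq_bigr => s _; rewrite exchange_big; apply: eq_bigr => t _.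
  by rewrite /C mulrz_sumr.
(* For fixed f the hypothesis reads sum_u f(Z u) g(q u) = 0 for every g. Hence the combination of
   the q u with coefficients f(Z u) lies in K2, and freeness of [q] makes each coefficient zero. *)
have ZK t : K1 (Z t).
  apply/K1E => f Ff.
  suff /free/rowP/(_ t) : K2 (lincomb q (\row_t f (Z t))) by rewrite !mxE.
  apply/K2E => g Fg; rewrite (morphD_lincomb (FBD Fg)) -[RHS](xy0 _ _ Ff Fg).
  have gq i (V : 'I_n -> 'rV_l) z : K2 (z i - lincomb q (V i)) ->
      g (z i) = \sum_u g (q u) *~ V i 0 u.
    move=> /K2E/(_ _ Fg); rewrite (morphDB (FBD Fg)) => /eqP; rewrite subr_eq0 => /eqP ->.
    exact: (morphD_lincomb (FBD Fg)).
  under eq_bigr => u _.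
    rewrite mxE /Z (morphD_sum (FAD Ff)) mulrz_sumr.
    under eq_bigr => i _ do
      rewrite (morphDB (FAD Ff)) !(morphDMz (FAD Ff)) !mulrzz mulrBr.
    over.
  rewrite exchange_big; apply: eq_bigr => i _ /=.
  rewrite (gq _ _ _ (YK i)) (gq _ _ _ (XK i)) !mulr_sumr -sumrB.
  by apply: eq_bigr => u _; rewrite !mulrzz; ring.
have kkK t : K2 (kk t).
  by apply: zsub_sum => // i _; apply: zsubB => //; apply: zsubMz.
have [a aP] := boolp.choice Hd.
have [a' a'P] := boolp.choice aP.
(* The combination of [q] with coefficients [c t] equals [Z t] - [kk t], an element of K1 + K2, so
   the stacked basis makes [d s] divide its coordinates. *)
pose g s t := ((c t 0 s)%R %/ d s)%Z.
have cE s t : c t 0 s = g s t * d s.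
  rewrite /g divzK //; apply: dH.
  exists (Z t), (- kk t); split; [exact: ZK|exact: zsubN|].
  by rewrite ZE addrAC subrr add0r.
have cN s t : c t 0 s = - c s 0 t by rewrite !mxE opprB.
have qE t : q t *~ d t = a t + a' t by case: (a'P t).
have aK t : K1 (a t) by case: (a'P t).
have a'K t : K2 (a' t) by case: (a'P t).
(* Replacing d_s q_s by a_s + a'_s in the formula for [Z t] and moving the K1 part to the other side
   shows that [eta] lies in both K1 and K2, where [w12] applies. *)
have eta0 t : w (kk t) (q t) = - \sum_s w (a' s) (q t) *~ g s t.
  pose eta := kk t + \sum_s a' s *~ g s t.
  have etaK2 : K2 eta by apply: zsubD => //; apply: zsub_sum => // s _; apply: zsubMz.
  have etaK1 : K1 eta.
    have -> : eta = Z t - \sum_s a s *~ g s t.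
      rewrite ZE -addrA; congr (_ + _); rewrite -sumrB; apply: eq_bigr => s _.
      by rewrite cE mulrC mulrzA qE mulrzDl addrC addKr.
    by apply: zsubB => //; apply: zsub_sum => // s _; apply: zsubMz.
  apply/eqP; rewrite -addr_eq0 -[X in _ == X](w12 (q t) etaK1 etaK2) wDl.
  apply/eqP; congr (_ + _); rewrite (morphD_sum (wDl _)).
  by apply: eq_bigr => s _; rewrite (morphDMz (wDl _)).
rewrite wE (eq_bigr _ (fun t _ => eta0 t)) sumrN exchange_big /= addrC -sumrB.
under eq_bigr => s _ do rewrite -sumrB.
apply: sum_antisym => [t|s t].
  by rewrite waa mul0rz sub0r /g mxE subrr div0z mulr0z oppr0.
have gE : g t s * d t = - (g s t * d s) by rewrite -!cE cN.
(* The integer g_st d_s = - g_ts d_t multiplies both q_s and q_t into K1 + K2, which is the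
   situation of [wW_int]. *)
have := @wW_int (g s t * d s) (q s) (q t) (a s *~ g s t) (a' s *~ g s t)
  (- (a t *~ g t s)) (- (a' t *~ g t s)).
rewrite (morphDN (wDr _)) !(morphDMz (wDr _)) (morphDMz (wDl _)) => wst.
have {}wst : w (a s) (q t) *~ g s t = - (w (q s) (a' t) *~ g t s).
  apply: wst; [exact: zsubMz|exact: zsubMz|by apply: zsubN => //; apply: zsubMz|
    by apply: zsubN => //; apply: zsubMz| |].
    by rewrite mulrC mulrzA qE mulrzDl.
  by rewrite -[_ * _]opprK -gE mulrNz mulrC mulrzA qE mulrzDl opprD.
rewrite [w (q t) (q s)]w_anti addrACA mulNrz -mulrzBr.
have -> : C s t - C t s = d s * g s t by rewrite mulrC -cE mxE.
rewrite mulrzA -(morphDMz (wDl _)) qE wDl mulrzDl wst.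
by rewrite [w (a' t) (q s)]w_anti mulNrz opprK addrA addrK addNr.
Qed.

End AlternatingForm.

(** * Subgroups and free groups *)

Local Close Scope ring_scope.
Local Open Scope group_scope.

(** Normalises group words, so that identities between commutators and conjugates are proved by
    rewriting. *)
Notation cgnorm := (commgEl, conjgE, gnorm).

Section Subgroup.
Variables (F : groupType) (A : set F).
Hypothesis sA : is_subgroup A.

Lemma subg1 : A 1. Proof. by case: sA. Qed.

Lemma subgM x y : A x -> A y -> A (x * y). Proof. by case: sA => _ + _; apply. Qed.

Lemma subgV x : A x -> A x^-1. Proof. by case: sA => _ _; apply. Qed.

Lemma subgMl x y : A x -> A (x * y) <-> A y.
Proof.
move=> Ax; split=> [Axy|]; last exact: subgM.
by rewrite -(mulKg x y); apply: subgM => //; apply: subgV.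
Qed.

Lemma subgMr x y : A y -> A (x * y) <-> A x.
Proof.
move=> Ay; split=> [Axy|Ax]; last exact: subgM.
by rewrite -(mulgK y x); apply: subgM => //; apply: subgV.
Qed.

Lemma subgR x y : A x -> A y -> A [~ x, y].
Proof. by move=> Ax Ay; do !apply: subgM => //; apply: subgV. Qed.

Lemma subgX x n : A x -> A (x ^+ n).
Proof. by move=> Ax; elim: n => [|n IH]; rewrite ?expgS; [apply: subg1 | apply: subgM]. Qed.
End Subgroup.

(** * Abelian quotients of subgroups *)

Section AbelianQuotient.
Variables (F : groupType) (P N : set F).
Hypotheses (sP : is_subgroup P) (sN : is_subgroup N).
Hypothesis PN : forall x y, P x -> P y -> N [~ x, y].

(** A chosen representative in [P] of the class of [x] modulo [N]. Outside [P] the value is that of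
    the trivial class, which makes the map total. *)
Let rep (x : F) : F :=
  if `[< P x >] then xget 1 [set y | P y /\ N (x^-1 * y)] else xget 1 [set y | P y /\ N y].

Let repP x : P x -> P (rep x) /\ N (x^-1 * rep x).
Proof.
move=> Px; rewrite /rep asboolT //; case: xgetP => [y _ []//|/(_ x)[]] /=.
by rewrite mulVg; split=> //; apply: subg1.
Qed.

Let eq_rep x y : P x -> P y -> N (x^-1 * y) -> rep x = rep y.
Proof.
move=> Px Py Nxy; rewrite /rep !asboolT //; congr (xget _ _).
have E z : x^-1 * z = x^-1 * y * (y^-1 * z) by rewrite mulgA mulgK.
apply/seteqP; split=> z [Pz Nz]; split=> //; move: Nz; rewrite E.
  by move/(subgMl sN _ Nxy).
by move=> Nz; apply: subgM.
Qed.

Let carrier := {x : F | P x /\ rep x = x}.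

Let cl_subproof x : P (rep x) /\ rep (rep x) = rep x.
Proof.
wlog Px : x / P x => [IH|].
  have [Px|nPx] := pselect (P x); first exact: IH.
  have -> : rep x = rep 1.
    rewrite /rep asboolF // asboolT ?invg1; last exact: subg1.
    by congr (xget _ _); apply/seteqP; split=> z /=; rewrite mul1g.
  by apply: IH; apply: subg1.
have [Prx Nrx] := repP Px; split=> //; apply/esym; exact: eq_rep.
Qed.

Let cl x : carrier := exist _ (rep x) (cl_subproof x).

Let eq_cl x y : P x -> P y -> N (x^-1 * y) -> cl x = cl y.
Proof. by move=> Px Py Nxy; apply: eq_exist; apply: eq_rep. Qed.

Let cl_eq x y : P x -> P y -> cl x = cl y -> N (x^-1 * y).
Proof.
move=> Px Py [] rxy; have [_ Nx] := repP Px; have [_ Ny] := repP Py.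
suff -> : x^-1 * y = (x^-1 * rep x) * (y^-1 * rep y)^-1 by apply: subgM => //; apply: subgV.
by rewrite rxy !cgnorm.
Qed.

Let add (a b : carrier) : carrier := cl (sval a * sval b).

Let clM x y : P x -> P y -> add (cl x) (cl y) = cl (x * y).
Proof.
move=> Px Py; have [Prx Nx] := repP Px; have [Pry Ny] := repP Py.
apply/esym/eq_cl; [exact: subgM|exact: subgM|].
set n := x^-1 * rep x in Nx.
(* The product is well defined because the only correction term, [n, y], is a commutator of elements
   of [P]. *)
have -> : (x * y)^-1 * (rep x * rep y) = n * [~ n, y] * (y^-1 * rep y).
  by rewrite /n !cgnorm.
apply: (subgM sN) => //; apply: (subgM sN) => //; apply: PN => //.
by apply: (subgM sP) => //; apply: subgV.
Qed.

Let clK a : cl (sval a) = a.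
Proof. by case: a => x [Px rx]; apply: eq_exist. Qed.

Let cl_surj a : exists x, P x /\ cl x = a.
Proof. by case: a => x [Px rx]; exists x; split=> //; apply: eq_exist. Qed.

(** [A] is the quotient of [P] by its intersection with [N], carried by the fixed points of [rep].
    It will be used for D/D' and for D'/N. *)
Lemma abelian_quotient : exists (A : zmodType) (c : F -> A),
  [/\ forall x y, P x -> P y -> c (x * y) = (c x + c y)%R,
      forall x, P x -> c x = 0%R <-> N x
    & forall a, exists x, P x /\ c x = a].
Proof.
pose opp (a : carrier) := cl (sval a)^-1.
have addA : associative add.
  move=> a b c; have [x [Px <-]] := cl_surj a; have [y [Py <-]] := cl_surj b.
  have [z [Pz <-]] := cl_surj c.
  by rewrite !clM ?mulgA //; apply: subgM.
have addC : commutative add.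
  move=> a b; have [x [Px <-]] := cl_surj a; have [y [Py <-]] := cl_surj b.
  rewrite !clM //; apply: eq_cl; [exact: subgM..|].
  by rewrite invgM -mulgA; apply: PN.
have add0 : left_id (cl 1) add.
  by move=> a; have [x [Px <-]] := cl_surj a; rewrite clM ?mul1g //; apply: subg1.
have addN : left_inverse (cl 1) opp add.
  move=> a; have [Pa _] := svalP a.
  by rewrite /opp -[X in add _ X]clK clM ?mulVg //; apply: subgV.
pose AddMixin := GRing.isZmodule.Build {classic carrier} addA addC add0 addN.
pose A : zmodType := HB.pack {classic carrier} AddMixin.
exists A, cl; split=> [x y Px Py|x Px|]; last exact: cl_surj.
  by rewrite -clM.
split=> [/(cl_eq Px)|Nx].
  by rewrite mulg1 => /(_ (subg1 sP)) /(subgV sN); rewrite invgK.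
by apply: eq_cl => //; rewrite ?mulg1; [exact: subg1|exact: subgV].
Qed.
End AbelianQuotient.

(** * Functions on a free group with prescribed increments *)

Section Semidirect.
Variables (F : groupType) (N : zmodType).

(* The first component g of a homomorphism w |-> (g w, w) satisfies g (w w') u = g w u + g w' (u w),
   so its value at u = 1 is a function on F with prescribed increments along the edges of the Cayley graph. *)
Definition semidirect : Type := ({classic (F -> N)} * F)%type.
HB.instance Definition _ := Choice.on semidirect.
Implicit Types p : semidirect.

Definition sd_mul p1 p2 : semidirect :=
  (fun u => p1.1 u + p2.1 (u * p1.2)%g, (p1.2 * p2.2)%g)%R.
Definition sd_one : semidirect := (fun _ => 0%R, 1).
Definition sd_inv p : semidirect := (fun u => (- p.1 (u * p.2^-1)%g)%R, p.2^-1).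

Fact sd_mulA : associative sd_mul.
Proof.
by move=> [a x] [b y] [c z]; congr pair; rewrite /= ?mulgA //; apply/funext => u; rewrite addrA mulgA.
Qed.

Fact sd_mul1 : left_id sd_one sd_mul.
Proof.
by move=> [a x]; congr pair; rewrite /= ?mul1g //; apply/funext => u; rewrite add0r mulg1.
Qed.

Fact sd_mulr1 : right_id sd_one sd_mul.
Proof.
by move=> [a x]; congr pair; rewrite /= ?mulg1 //; apply/funext => u; rewrite addr0.
Qed.

Fact sd_mulV : left_inverse sd_one sd_inv sd_mul.
Proof.
move=> [a x]; congr pair; rewrite /= ?mulVg //; apply/funext => u.
by rewrite addNr.
Qed.

Fact sd_mulVr : right_inverse sd_one sd_inv sd_mul.
Proof.
move=> [a x]; congr pair; rewrite /= ?mulgV //; apply/funext => u.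
by rewrite mulgK subrr.
Qed.

HB.instance Definition _ :=
  isGroup.Build semidirect sd_mulA sd_mul1 sd_mulr1 sd_mulV sd_mulVr.

Lemma sd_mulE (p1 p2 : semidirect) : p1 * p2 = sd_mul p1 p2.
Proof. by []. Qed.

Variables (X : Type) (i : X -> F).
Hypothesis basis_i : is_basis i.

(** The homomorphisms w |-> (u |-> h(uw) - h(u), w) and w |-> (0, w) agree on the basis, hence
    everywhere. *)
Lemma free_unique (h : F -> N) : (forall u x, h (u * i x) = h u) -> forall u, h u = h 1.
Proof.
move=> hx.
pose phi (w : F) : semidirect := (fun u => h (u * w)%g - h u, w)%R.
pose psi (w : F) : semidirect := (fun u => 0, w)%R.
have phiM : {morph phi : x y / x * y}.
  by move=> x y; congr pair; apply/funext => u /=; rewrite mulgA [RHS]addrC addrA subrK.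
have psiM : {morph psi : x y / x * y}.
  by move=> x y; congr pair; apply/funext => u /=; rewrite addr0.
have [_ uniq] := basis_i (fun x => psi (i x)).
pose phi' : {multiplicative F -> semidirect} := HB.pack phi (monoid.isMultiplicative.Build _ _ phi phiM).
pose psi' : {multiplicative F -> semidirect} := HB.pack psi (monoid.isMultiplicative.Build _ _ psi psiM).
have phipsi : forall x, phi' (i x) = psi' (i x).
  by move=> x; congr pair; apply/funext => u /=; rewrite hx subrr.
move=> u; have := uniq phi' psi' phipsi u => /(congr1 (fun p => p.1 1)) /=.
by rewrite mul1g => /GRing.subr0_eq.
Qed.

Lemma free_integral (c : F -> X -> N) :
  exists g : F -> N, g 1 = 0%R /\ forall u x, g (u * i x) = (g u + c u x)%R.
Proof.
have [[phi phiE] _] := basis_i (fun x => (fun u => c u x, i x) : semidirect).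
(* The second component is an endomorphism fixing the basis, so the increment at the prefix u is
   indeed taken at u. *)
have phi2 w : (phi w).2 = w.
  pose snd_phi w := (phi w).2.
  have sndM : {morph snd_phi : x y / x * y} by move=> x y; rewrite /snd_phi gmulfM.
  pose p : {multiplicative F -> F} := HB.pack snd_phi (monoid.isMultiplicative.Build _ _ snd_phi sndM).
  have [_ uniq] := basis_i i; apply: (uniq p idfun) => x.
  by rewrite /= /snd_phi phiE.
exists (fun w => (phi w).1 1); split=> [|u x].
  suff -> : phi 1 = 1 by [].
  by apply: (mulgI (phi 1)); rewrite -gmulfM !mulg1.
by rewrite gmulfM sd_mulE phiE /= mul1g phi2.
Qed.

End Semidirect.

(** * Generated subgroups and commutator subgroups *)

Section Generated.
Variable F : groupType.
Implicit Types A B P : set F.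

Lemma sub_generated A : A `<=` generated A.
Proof. by move=> x Ax B [_]; apply. Qed.

Lemma generated_min A B : is_subgroup B -> A `<=` B -> generated A `<=` B.
Proof. by move=> sB AB x; apply. Qed.

Lemma generated_subgroup A : is_subgroup (generated A).
Proof.
split=> [B [sB _]|x y Ax Ay B [sB AB]|x Ax B [sB AB]]; first exact: (subg1 sB).
  by apply: (subgM sB); [apply: Ax|apply: Ay].
by apply: (subgV sB); apply: Ax.
Qed.

Lemma commutator_subgroup_subgroup A B : is_subgroup (commutator_subgroup A B).
Proof. exact: generated_subgroup. Qed.

Lemma commutator_subgroupR A B x y : A x -> B y -> commutator_subgroup A B [~ x, y].
Proof. by move=> Ax By; apply: sub_generated; exists x => //; exists y. Qed.

Lemma commutator_subgroup_min A B P : is_subgroup P ->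
  (forall x y, A x -> B y -> P [~ x, y]) -> commutator_subgroup A B `<=` P.
Proof. by move=> sP AB; apply: generated_min => // _ [x Ax [y By <-]]; apply: AB. Qed.

Lemma commutator_subgroupS A B A' B' : A `<=` A' -> B `<=` B' ->
  commutator_subgroup A B `<=` commutator_subgroup A' B'.
Proof.
move=> AA' BB'; apply: commutator_subgroup_min; first exact: commutator_subgroup_subgroup.
by move=> x y /AA' Ax /BB'; apply: commutator_subgroupR.
Qed.

Lemma derived_sub A : is_subgroup A -> derived_subgroup A `<=` A.
Proof. by move=> sA; apply: commutator_subgroup_min => // x y; apply: subgR. Qed.

Lemma is_subgroupI A B : is_subgroup A -> is_subgroup B -> is_subgroup (A `&` B).
Proof.
move=> sA sB.
by split=> [|x y [? ?] [? ?]|x [? ?]]; split; do ?[exact: subg1|exact: subgM|exact: subgV].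
Qed.

(* Since [y, x] is the inverse of [x, y], products of commutators exhaust the derived subgroup. *)
Lemma derivedP A x : derived_subgroup A x ->
  exists n, exists a b : 'I_n -> F,
    (forall i, A (a i) /\ A (b i)) /\ x = \prod_i [~ a i, b i].
Proof.
move: x; apply: commutator_subgroup_min; last first.
  by move=> x y Ax Ay; exists 1%N, (fun=> x), (fun=> y); split=> //; rewrite big_ord_recl big_ord0 mulg1.
split=> [|x y [n [a [b [ab ->]]]] [m [c [d [cd ->]]]]|x [n [a [b [ab ->]]]]].
- by exists 0%N, (fun=> 1), (fun=> 1); split=> [[]//|]; rewrite big_ord0.
- exists (n + m)%N.
  exists (fun i => match split i with inl j => a j | inr j => c j end).
  exists (fun i => match split i with inl j => b j | inr j => d j end).
  split=> [i|]; first by case: (split i).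
  rewrite big_split_ord /=; congr (_ * _); apply: eq_bigr => i _.
    by rewrite -[lshift _ _]/(unsplit (inl i)) unsplitK.
  by rewrite -[rshift _ _]/(unsplit (inr i)) unsplitK.
- exists n, (fun i => b (rev_ord i)), (fun i => a (rev_ord i)); split=> [i|].
    by case: (ab (rev_ord i)).
  elim: n a b {ab} => [|n IH] a b; first by rewrite !big_ord0 invg1.
  rewrite big_ord_recl invgM IH invgR [RHS]big_ord_recr /=; congr (_ * _).
    apply: eq_bigr => i _; have -> // : lift ord0 (rev_ord i) = rev_ord (widen_ord (leqnSn n) i).
    by apply: val_inj; rewrite /= /bump; have := ltn_ord i; lia.
  have -> // : rev_ord ord_max = ord0 :> 'I_n.+1 by apply: val_inj; rewrite /= subnn.
Qed.
End Generated.

(** * Functionals on the group ring *)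

Local Close Scope group_scope.
Local Open Scope ring_scope.

Section LinearExtension.
Variables (F : groupType) (N : zmodType).
Implicit Types (phi : F -> N) (z : group_ring F).

Definition lin phi z : N := \sum_(k <- msupp z) phi k *~ z@_k.

Lemma linEw phi z (d : {fset F}) : (msupp z `<=` d)%fset ->
  lin phi z = \sum_(k <- d) phi k *~ z@_k.
Proof.
move=> le_d; apply: big_fset_incl => // k _ /mcoeff_outdom ->.
by rewrite mulr0z.
Qed.

Lemma linD phi : {morph lin phi : x y / x + y}.
Proof.
move=> x y; rewrite (linEw phi (fsubsetUl (msupp x) (msupp y))).
rewrite (linEw phi (fsubsetUr (msupp x) (msupp y))) (linEw phi (msuppD_le _ _)).
by rewrite -big_split /=; apply: eq_bigr => k _; rewrite mcoeffD mulrzDr.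
Qed.

Lemma lin_elt phi u : lin phi (group_elt u) = phi u.
Proof.
by rewrite (linEw phi (msuppU_le : (msupp (group_elt u) `<=` _)%fset)) big_seq_fset1 mcoeffUU mulr1z.
Qed.

Lemma group_ring_ext (f1 f2 : group_ring F -> N) :
  {morph f1 : x y / x + y} -> {morph f2 : x y / x + y} ->
  (forall u, f1 (group_elt u) = f2 (group_elt u)) -> f1 =1 f2.
Proof.
move=> f1D f2D f12 z; rewrite (monalgE z) (morphD_sum f1D) (morphD_sum f2D).
apply: eq_bigr => k _.
have -> : << z@_k *g k >> = group_elt k *~ z@_k :> group_ring F.
  have UD : {morph (fun c : int => << c *g k >> : group_ring F) : x y / x + y}.
    exact: monalgUD.
  by rewrite -[in LHS](intz z@_k) (morphDMz UD).
by rewrite (morphDMz f1D) (morphDMz f2D) f12.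
Qed.

Lemma lin_mull phi z c :
  lin phi (c * z) = lin (fun v => lin phi (group_elt v * z)) c.
Proof.
apply: (group_ring_ext (f1 := fun c => lin phi (c * z))) c; last by move=> u; rewrite lin_elt.
  by move=> x y; rewrite mulrDl linD.
exact: linD.
Qed.

Lemma lin_mulr phi z c :
  lin phi (z * c) = lin (fun v => lin phi (z * group_elt v)) c.
Proof.
apply: (group_ring_ext (f1 := fun c => lin phi (z * c))) c; last by move=> u; rewrite lin_elt.
  by move=> x y; rewrite mulrDr linD.
exact: linD.
Qed.

Lemma lin_eltl phi v z : lin phi (group_elt v * z) = lin (fun u => phi (v * u)%g) z.
Proof. by rewrite lin_mulr; congr lin; apply/funext => u; rewrite -group_eltM lin_elt. Qed.

Lemma lin_eltr phi v z : lin phi (z * group_elt v) = lin (fun u => phi (u * v)%g) z.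
Proof. by rewrite lin_mull; congr lin; apply/funext => u; rewrite -group_eltM lin_elt. Qed.

Lemma linB_fun phi psi z : lin (fun u => phi u - psi u) z = lin phi z - lin psi z.
Proof. by rewrite /lin -sumrB; apply: eq_bigr => k _; rewrite mulrzBl. Qed.

Lemma lin0_fun z : lin (fun=> 0) z = 0.
Proof. by rewrite /lin big1 // => k _; rewrite mul0rz. Qed.

End LinearExtension.

(** * Functions whose extension vanishes on an ideal *)

Section Annihilators.
Variables (F : groupType) (N : zmodType).
Implicit Types (phi : F -> N) (G R S : set F).

(** The elements killed by all left G-invariant functions at once form a two-sided ideal containing
    G - 1: multiplication by a group element translates the function, and normality of [G] preserves
    its invariance. *)
Lemma lin_relative_ideal G phi z : is_normal_subgroup G ->
  (forall x u, G x -> phi (x * u)%g = phi u) -> relative_ideal G z -> lin phi z = 0.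
Proof.
move=> [sG nG] phiG Gz.
pose inv psi := forall x u, G x -> psi (x * u)%g = psi u :> N.
pose J : set (group_ring F) := [set z | forall psi, inv psi -> lin psi z = 0].
suff Jz : J z by exact: Jz.
apply: Gz; split; last first.
  by move=> _ [x Gx <-] psi ipsi; rewrite (morphDB (linD psi)) !lin_elt -[x]mulg1 ipsi // subrr.
split=> [|c a Ja psi ipsi|c a Ja psi ipsi].
- split=> [psi _|a b Ja Jb psi ipsi]; first exact: (morphD0 (linD psi)).
  by rewrite (morphDB (linD psi)) Ja // Jb // subrr.
- rewrite lin_mull -[RHS](lin0_fun (F := F) N c); congr lin; apply/funext => v.
  rewrite lin_eltl; apply: Ja => x u Gx.
  have -> : (v * (x * u) = x ^ (v^-1) * (v * u))%g. by rewrite !cgnorm.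
  by apply: ipsi; apply: nG.
- rewrite lin_mulr -[RHS](lin0_fun (F := F) N c); congr lin; apply/funext => v.
  by rewrite lin_eltr; apply: Ja => x u Gx /=; rewrite -mulgA; apply: ipsi.
Qed.

Lemma lin_relative_ideal_r G phi z : is_normal_subgroup G ->
  (forall x u, G x -> phi (u * x)%g = phi u) -> relative_ideal G z -> lin phi z = 0.
Proof.
move=> nG phiG; apply: (lin_relative_ideal nG) => x u Gx.
by rewrite conjgC phiG //; apply: nG.2.
Qed.

(** The factors are removed one at a time. The factor in s is replaced by a difference under right
    translation by y in [S], the factor in r by one under left translation by x in [R]. What remains
    is the constant function [Theta x y], which f kills. *)
Lemma lin_rfs R S (Phi : F -> N) (Theta : F -> F -> N) z :
  is_normal_subgroup R -> is_normal_subgroup S ->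
  (forall x u y, R x -> S y ->
     Phi (x * u * y)%g - Phi (x * u)%g - (Phi (u * y)%g - Phi u) = Theta x y) ->
  ideal_mul (ideal_mul (relative_ideal R) (relative_ideal [set: F])) (relative_ideal S) z ->
  lin Phi z = 0.
Proof.
move=> nR nS PhiE.
have ker_add (psi : F -> N) : is_additive_subgroup [set z | lin psi z = 0].
  split=> [|a b /= a0 b0]; first exact: (morphD0 (linD psi)).
  by rewrite /= (morphDB (linD psi)) a0 b0 subrr.
move=> /(_ [set z | lin Phi z = 0]); apply; split; first exact: ker_add.
move=> _ [p rfp [c sc <-]] /=.
rewrite lin_mulr; apply: (lin_relative_ideal_r nS) sc => y v Sy.
apply/eqP; rewrite -subr_eq0 !lin_eltr -linB_fun; apply/eqP.
set phi2 := fun u => _.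
apply: (rfp [set z | lin phi2 z = 0]); split; first exact: ker_add.
move=> _ [a ra [b fb <-]] /=.
rewrite lin_mull; apply: (lin_relative_ideal nR) ra => x u Rx.
apply/eqP; rewrite -subr_eq0 !lin_eltl -linB_fun; apply/eqP.
have nT : is_normal_subgroup [set: F] by [].
apply: (lin_relative_ideal nT) fb => k l _.
have E w : phi2 (x * u * w)%g - phi2 (u * w)%g = Theta x y.
  by rewrite /phi2 -(PhiE x (u * w * v)%g y Rx Sy) !mulgA.
by rewrite !E.
Qed.

Lemma rfs_const R S (Phi : F -> N) (Theta : F -> F -> N) w :
  is_normal_subgroup R -> is_normal_subgroup S ->
  (forall x u y, R x -> S y ->
     Phi (x * u * y)%g - Phi (x * u)%g - (Phi (u * y)%g - Phi u) = Theta x y) ->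
  ideal_subgroup (ideal_mul (ideal_mul (relative_ideal R) (relative_ideal [set: F]))
    (relative_ideal S)) w ->
  Phi w = Phi 1%g.
Proof.
move=> nR nS PhiE /(lin_rfs nR nS PhiE); rewrite (morphDB (linD _)) !lin_elt.
exact: subr0_eq.
Qed.

End Annihilators.

(** * Transversals and functions with prescribed second differences *)

Section Transversal.
Variables (F : groupType) (D : set F).
Hypothesis sD : is_subgroup D.
Local Open Scope group_scope.

Lemma transversal_proj : exists q : F -> F,
  [/\ forall u, D (q u), forall d u, D d -> q (d * u) = d * q u
    & forall d, D d -> q d = d].
Proof.
pose t u := xget 1 [set v | D (u * v^-1)].
have tD u : D (u * (t u)^-1).
  by rewrite /t; case: xgetP => [v _ //|/(_ u)[]] /=; rewrite mulgV; apply: subg1.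
have tM d u : D d -> t (d * u) = t u.
  move=> Dd; congr xget; apply/seteqP; split=> v /=; rewrite -mulgA.
    by move/(subgMl sD _ Dd).
  by move=> Dv; apply/(subgMl sD _ Dd).
pose q u := u * (t u)^-1.
have qM d u : D d -> q (d * u) = d * q u by move=> Dd; rewrite /q tM // mulgA.
(* Here u = q(u) t(u) with t(u) representing the coset Du; the factor q(1)^-1 normalises the
   projection to be the identity on [D]. *)
exists (fun u => q u * (q 1)^-1); split=> [u|d u Dd|d Dd].
- by apply: (subgM sD); [apply: tD|apply: (subgV sD); apply: tD].
- by rewrite qM // -mulgA.
- by have := qM d 1 Dd; rewrite mulg1 => ->; rewrite mulgK.
Qed.

End Transversal.

(** A homomorphism on [R] is carried by a function on all of [F]; its values off [R] are
    arbitrary. *)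
Definition hom_on (F : groupType) (N : zmodType) (R : set F) (a : F -> N) : Prop :=
  forall u v, R u -> R v -> a (u * v)%g = a u + a v.

Lemma hom_on1 (F : groupType) (N : zmodType) (R : set F) (a : F -> N) :
  is_subgroup R -> hom_on R a -> a 1%g = 0.
Proof.
move=> sR aR; apply: (addrI (a 1%g)); rewrite -aR ?mulg1 ?addr0 //; exact: subg1.
Qed.

Lemma hom_onV (F : groupType) (N : zmodType) (R : set F) (a : F -> N) x :
  is_subgroup R -> hom_on R a -> R x -> a (x^-1)%g = - a x.
Proof.
move=> sR aR Rx; apply: (addrI (a x)); rewrite -aR ?mulgV ?subrr //; last exact: subgV.
exact: (hom_on1 sR aR).
Qed.

Section DoubleCoset.
Variables (F : groupType) (N : zmodType) (R S : set F) (delta : F -> N).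
Hypotheses (sR : is_subgroup R) (sS : is_subgroup S) (homd : hom_on (R `&` S) delta).

(** [Phi] is a(x) + b(y) at xy in RS and 0 elsewhere. It is well defined because a(xd) = a(x) +
    delta(d) and b(dy) = delta(d) + b(y) for d in the intersection, so moving d from one factor to
    the other changes nothing. *)
Lemma rs_functional : exists Phi : F -> N,
  (forall x u y, R x -> S y ->
    Phi (x * u * y)%g - Phi (x * u)%g - (Phi (u * y)%g - Phi u) = 0) /\
  forall w, (R `&` S) w -> Phi w - Phi 1%g = delta w.
Proof.
have sD : is_subgroup (R `&` S).
  split=> [|x y [? ?] [? ?]|x [? ?]]; split; do ?[exact: subg1|exact: subgM|exact: subgV].
have [q [qD qM qd]] := transversal_proj sD.
pose a x := - delta (q (x^-1)%g).
pose b y := delta (q y).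
have bM d y : (R `&` S) d -> b (d * y)%g = delta d + b y.
  by move=> Dd; rewrite /b qM // homd.
have aM d x : (R `&` S) d -> a (x * d)%g = a x + delta d.
  move=> Dd; rewrite /a invgM qM ?homd ?(hom_onV sD homd) //; try exact: (subgV sD).
  by rewrite opprD opprK addrC.
pose RS u p := [/\ R p.1, S p.2 & u = (p.1 * p.2)%g].
pose f u := xget (1%g, 1%g) (RS u).
pose Phi u := if `[< exists p, RS u p >] then a (f u).1 + b (f u).2 else 0.
have PhiE x y : R x -> S y -> Phi (x * y)%g = a x + b y.
  move=> Rx Sy; have RSxy : RS (x * y)%g (x, y) by [].
  rewrite /Phi asboolT; last by exists (x, y).
  rewrite /f; case: xgetP => [[x' y'] _ /= [/= Rx' Sy' E]|/(_ _ RSxy)//].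
  have dE : (x'^-1 * x = y' * y^-1)%g.
    by apply: (mulgI x'); rewrite mulVKg mulgA -E mulgK.
  have Dd : (R `&` S) (x'^-1 * x)%g.
    split; last rewrite dE; apply: subgM => //; exact: subgV.
  have -> : x = (x' * (x'^-1 * x))%g by rewrite mulVKg.
  have -> : y' = ((x'^-1 * x) * y)%g by rewrite dE mulgVK.
  by rewrite aM // bM // addrA.
exists Phi; split=> [x u y Rx Sy|w Dw]; last first.
  rewrite -[X in Phi X - _]mulg1 -[X in _ - Phi X](mulg1 1%g) !PhiE; try exact: subg1; last by case: Dw.
  by rewrite -[w]mul1g aM // mul1g opprD addrACA subrr addr0 addrAC subrr add0r.
have [[[s t] [/= Rs St ->]]|nRS] := pselect (exists p, RS u p).
  rewrite mulgA -[(x * s * t * y)%g]mulgA -[(s * t * y)%g]mulgA !PhiE //; try exact: subgM.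
  by rewrite opprD addrACA subrr add0r opprD addrACA subrr add0r subrr.
(* RS is stable under [R] on the left and [S] on the right, so if u is outside it, all four points
   are, and [Phi] vanishes at each. *)
have Phi0 v : (exists2 x', R x' & exists2 y', S y' & u = (x' * v * y')%g) -> Phi v = 0.
  move=> [x' Rx' [y' Sy' uE]]; rewrite /Phi asboolF // => -[[s t] [/= Rs St vE]]; apply: nRS.
  exists (x' * s, t * y')%g; split; [exact: subgM|exact: subgM|].
  by rewrite uE vE !mulgA.
rewrite !Phi0 ?subrr //.
- by exists 1%g; [exact: subg1|exists 1%g; [exact: subg1|rewrite !cgnorm]].
- by exists 1%g; [exact: subg1|exists y^-1%g; [exact: subgV|rewrite !cgnorm]].
- by exists x^-1%g; [exact: subgV|exists 1%g; [exact: subg1|rewrite !cgnorm]].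
- by exists x^-1%g; [exact: subgV|exists y^-1%g; [exact: subgV|rewrite !cgnorm]].
Qed.

End DoubleCoset.

(** * Functionals obtained from freeness *)

Section FreeFunctionals.
Variable F : groupType.
Hypothesis freeF : is_free_group F.

(** [g t] sums the values of [a] along the translate by t against the increments of [b], as in a
    Stieltjes integral along the Cayley tree. Translating t by x in [R] adds a(x) b, and on [S]
    there is the cocycle rule g_t(su) = g_t(s) + g_ts(u). [Phi] integrates this cocycle over the
    left cosets of [S]. *)
Lemma rfs_functional (R S : set F) (a b : F -> int) :
  is_subgroup R -> is_subgroup S -> hom_on R a -> hom_on S b ->
  exists Phi : F -> int, forall x u y, R x -> S y ->
    Phi (x * u * y)%g - Phi (x * u)%g - (Phi (u * y)%g - Phi u) = a x * b y.
Proof.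
move=> sR sS aR bS; have [X [i bi]] := freeF.
have [r [rR rM _]] := transversal_proj sR.
have [q [qS qM qs]] := transversal_proj sS.
have arM x u : R x -> a (r (x * u)%g) = a x + a (r u) by move=> Rx; rewrite rM // aR.
have intg t : exists g : F -> int, g 1%g = 0 /\ forall u x, g (u * i x)%g =
    g u + a (r (t * q u)%g) * (b (q (u * i x)%g) - b (q u)).
  exact: (free_integral bi (fun u x => a (r (t * q u)%g) * (b (q (u * i x)%g) - b (q u)))).
have [g gP] := boolp.choice intg.
have g1 t : g t 1%g = 0 by case: (gP t).
have gX t u x : g t (u * i x)%g = g t u + a (r (t * q u)%g) * (b (q (u * i x)%g) - b (q u)).
  by case: (gP t).
have gR x t u : R x -> g (x * t)%g u - g t u = a x * b (q u).
  move=> Rx; apply/eqP; rewrite -subr_eq0; apply/eqP.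
  rewrite (free_unique bi (h := fun u => g (x * t)%g u - g t u - a x * b (q u))).
    by rewrite !g1 qs ?(hom_on1 sS bS) ?mulr0 ?subrr //; apply: subg1.
  by move=> {}u y; rewrite !gX -(mulgA x t) (arM x) //; ring.
have gS s t u : S s -> g t (s * u)%g = g t s + g (t * s)%g u.
  move=> Ss; have := free_unique bi (h := fun u => g t (s * u)%g - g (t * s)%g u) _ u.
  rewrite mulg1 g1 subr0 => <-; first by rewrite subrK.
  by move=> {}u y; rewrite mulgA !gX -[(s * u * i y)%g]mulgA !(qM s) // !bS // !mulgA; ring.
(* Writes u = ts with s in [S] and t depending only on uS, and takes g_t(s); by the cocycle rule the
   increment from u to uy is g_u(y). *)
pose Phi u := g (u * q (u^-1)%g)%g (q (u^-1)%g)^-1%g.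
have PhiE u y : S y -> Phi (u * y)%g - Phi u = g u y.
  move=> Sy; rewrite /Phi invgM qM; last exact: subgV.
  rewrite mulgA mulgK invgM invgK gS; last exact: subgV.
  by rewrite mulgK addrAC subrr add0r.
exists Phi => x u y Rx Sy.
by rewrite !PhiE // gR // qs.
Qed.

(** As in Reidemeister-Schreier rewriting, [g] records with signed multiplicity the elements of [R]
    read along a word. The group ring serves only as the free abelian group on [F]. The coefficients
    of [g] are homomorphisms on [R], so g(x) = 0, while [g] determines the class of x modulo R'. *)
Lemma derived_separated (R : set F) x : is_subgroup R -> R x ->
  (forall a : F -> int, hom_on R a -> a x = 0) -> derived_subgroup R x.
Proof.
move=> sR Rx ax0; have [X [i bi]] := freeF.
have [q [qR qM qr]] := transversal_proj sR.
have sR' : is_subgroup (derived_subgroup R) by apply: commutator_subgroup_subgroup.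
have RR' u v : R u -> R v -> derived_subgroup R [~ u, v]%g by apply: commutator_subgroupR.
have [A [cl [clM cl0 _]]] := abelian_quotient sR sR' RR'.
have [g [g1 gX]] := free_integral bi
  (fun u x => << ((q u)^-1 * q (u * i x))%g >> : {malg int[F]}).
have gM : hom_on R g.
  move=> s u Rs _; have := free_unique bi (h := fun u => g (s * u)%g - g u) _ u.
  rewrite mulg1 g1 subr0 => <-; first by rewrite subrK.
  move=> {}u y; rewrite mulgA !gX -[(s * u * i y)%g]mulgA !(qM s) // invgM -mulgA mulKg.
  by rewrite opprD addrACA subrr addr0.
have gx0 : g x = 0.
  apply/malgP => y; rewrite mcoeff0; apply: (ax0 (fun u => (g u)@_y)) => u v Ru Rv.
  by rewrite gM // mcoeffD.
have cl1 : cl 1%g = 0 by apply/cl0; [exact: subg1|exact: subg1].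
(* Summing the recorded classes recovers the class of q(u): the difference has zero increments, so
   it is constant. *)
have clX u y : lin cl (g (u * i y)%g) - cl (q (u * i y)%g) = lin cl (g u) - cl (q u).
  rewrite gX linD [lin cl << _ >>]lin_elt -[X in _ - cl X](mulVKg (q u)) (clM (q u)) //.
    by rewrite opprD addrACA subrr addr0.
  by apply: (subgM sR) => //; apply: (subgV sR).
have := free_unique bi clX x.
rewrite gx0 g1 (morphD0 (linD cl)) !qr ?cl1 //; last exact: subg1.
by rewrite subr0 sub0r => /eqP; rewrite oppr_eq0 => /eqP/cl0; apply.
Qed.

End FreeFunctionals.

(** * Elements of 1 + rfs *)

Section Ideals.
Variable T : nzRingType.
Implicit Types I J : set T.

Lemma ideal_generated_ideal (A : set T) : is_ideal (ideal_generated A).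
Proof.
split=> [|c a Aa B BA|c a Aa B BA].
- split=> [B [[[B0 _] _ _] _] //|a b Aa Ab B BA].
  by have [[[_ BB] _ _] _] := BA; apply: BB; [apply: Aa|apply: Ab].
- by have [[_ lB _] _] := BA; apply: lB; apply: Aa.
- by have [[_ _ rB] _] := BA; apply: rB; apply: Aa.
Qed.

Lemma sub_ideal_generated (A : set T) : A `<=` ideal_generated A.
Proof. by move=> a Aa B [_]; apply. Qed.

Lemma mem_ideal_mul I J a b : I a -> J b -> ideal_mul I J (a * b).
Proof. by move=> Ia Jb B [_]; apply; exists a => //; exists b. Qed.

Lemma ideal_mul_min I J (B : set T) : is_additive_subgroup B ->
  (forall a b, I a -> J b -> B (a * b)) -> ideal_mul I J `<=` B.
Proof. by move=> sB IJ z; apply; split=> // _ [a Ia [b Jb <-]]; apply: IJ. Qed.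

Lemma ideal_mul_additive I J : is_additive_subgroup (ideal_mul I J).
Proof.
split=> [B [[B0 _] _] //|a b Ia Ib B BA].
by have [[_ BB] _] := BA; apply: BB; [apply: Ia|apply: Ib].
Qed.

Lemma ideal_mul_ideal I J : is_ideal I -> is_ideal J -> is_ideal (ideal_mul I J).
Proof.
move=> [_ lI _] [_ _ rJ].
have [IJ0 IJB] := ideal_mul_additive I J.
split=> // c.
  apply: ideal_mul_min => [|a b Ia Jb].
    by split=> [|a b] /=; rewrite ?mulr0 // mulrBr; apply: IJB.
  by rewrite /= mulrA; exact: (mem_ideal_mul (lI _ _ Ia) Jb).
apply: ideal_mul_min => [|a b Ia Jb].
  by split=> [|a b] /=; rewrite ?mul0r // mulrBl; apply: IJB.
by rewrite /= -mulrA; exact: (mem_ideal_mul Ia (rJ _ _ Jb)).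
Qed.

Lemma ideal_mulA I J K a b :
  I a -> ideal_mul J K b -> ideal_mul (ideal_mul I J) K (a * b).
Proof.
move=> Ia; move: b; apply: ideal_mul_min => [|x y Jx Ky].
  have [B0 BB] := ideal_mul_additive (ideal_mul I J) K.
  by split=> [|x y] /=; rewrite ?mulr0 // mulrBr; apply: BB.
by rewrite /= mulrA; exact: (mem_ideal_mul (mem_ideal_mul Ia Jx) Ky).
Qed.

End Ideals.

Section DimensionSubgroup.
Variable F : groupType.
Local Notation "'E" := (@group_elt F) (at level 0).
Implicit Types I : set (group_ring F).

Lemma mul_subr1 (T : nzRingType) (x y : T) : (x - 1) * (y - 1) = x * y - (x + y - 1).
Proof. by rewrite mulrBl mul1r mulrBr mulr1 -addrA -opprD addrA. Qed.

Lemma group_elt_mulB1 (x y : F) :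
  'E (x * y)%g - 1 = ('E x - 1) * ('E y - 1) + (('E x - 1) + ('E y - 1)).
Proof. rewrite mul_subr1 group_eltM.
have -> : ('E x - 1) + ('E y - 1) = ('E x + 'E y - 1) - 1 by rewrite addrACA addrA.
by rewrite addrA subrK. Qed.

Lemma group_elt_comm (x y : F) : 'E [~ x, y]%g - 1 =
  'E (x^-1 * y^-1)%g * (('E x - 1) * ('E y - 1) - ('E y - 1) * ('E x - 1)).
Proof.
rewrite !mul_subr1 ['E y + _]addrC.
set B := _ + _ - 1; rewrite (opprB ('E y * 'E x)) addrA subrK mulrBr -!group_eltM.
by congr ('E _ - _); rewrite !cgnorm.
Qed.

Lemma group_eltVK (x : F) : 'E x * 'E (x^-1)%g = 1.
Proof. by rewrite -group_eltM mulgV. Qed.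

Lemma ideal_subgroup_subgroup I : is_ideal I -> is_subgroup (ideal_subgroup I).
Proof.
move=> [sI lI rI]; have zI : zmod_subgroup I := sI.
split=> [|x y Ix Iy|x Ix]; rewrite /ideal_subgroup /=.
- by rewrite group_elt1 subrr; apply: (zsub0 zI).
- rewrite group_elt_mulB1; apply: (zsubD zI); first exact: rI.
  exact: (zsubD zI).
- have -> : 'E (x^-1)%g - 1 = - (('E x - 1) * 'E (x^-1)%g).
    by rewrite mulrBl group_eltVK mul1r opprB.
  by apply: (zsubN zI); apply: rI.
Qed.

Lemma ideal_subgroup_comm I x y : is_ideal I ->
  I (('E x - 1) * ('E y - 1)) -> I (('E y - 1) * ('E x - 1)) -> ideal_subgroup I [~ x, y]%g.
Proof.
move=> [sI lI _] Ixy Iyx; rewrite /ideal_subgroup /= group_elt_comm.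
by apply: lI; exact: (zsubB (sI : zmod_subgroup I)).
Qed.

(** Modulo [I] the two product hypotheses make u - 1 additive along the powers of x and along x1 x2,
    so both sides of [x ^+ m = x1 * x2] can be expanded linearly. *)
Lemma power_mod I x m x1 x2 : is_ideal I ->
  (forall n, I (('E x - 1) * ('E (x ^+ n)%g - 1))) ->
  I (('E x1 - 1) * ('E x2 - 1)) -> (x ^+ m = x1 * x2)%g ->
  I (('E x1 - 1) + ('E x2 - 1) - ('E x - 1) *+ m).
Proof.
move=> [sI _ _] Ix I12 xm; have zI : zmod_subgroup I := sI.
have Im n : I ('E (x ^+ n)%g - 1 - ('E x - 1) *+ n).
  elim: n => [|n IH]; first by rewrite expg0 group_elt1 subrr mulr0n subr0; apply: (zsub0 zI).
  rewrite expgS group_elt_mulB1 mulrS -addrA; apply: (zsubD zI) => //.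
  by rewrite opprD addrACA subrr add0r.
have -> : ('E x1 - 1) + ('E x2 - 1) - ('E x - 1) *+ m =
    ('E (x ^+ m)%g - 1 - ('E x - 1) *+ m) - ('E x1 - 1) * ('E x2 - 1).
  by rewrite xm group_elt_mulB1 [RHS]addrAC [in RHS](addrC (_ * _)) addrK.
exact: (zsubB zI).
Qed.

Lemma relative_ideal_elt (G : set F) x : G x -> relative_ideal G ('E x - 1).
Proof. by move=> Gx; apply: sub_ideal_generated; exists x. Qed.

Section RFS.
Variables R S : set F.
Hypotheses (nR : is_normal_subgroup R) (nS : is_normal_subgroup S).
Let sR : is_subgroup R := nR.1.
Let sS : is_subgroup S := nS.1.
Let r := relative_ideal R.
Let f := relative_ideal [set: F].
Let s := relative_ideal S.
Let rf := ideal_mul r f.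
Let fs := ideal_mul f s.
Let rfs := ideal_mul rf s.
Let iir : is_ideal r. Proof. exact: ideal_generated_ideal. Qed.
Let iif : is_ideal f. Proof. exact: ideal_generated_ideal. Qed.
Let iis : is_ideal s. Proof. exact: ideal_generated_ideal. Qed.
Let irf : is_ideal rf. Proof. exact: ideal_mul_ideal. Qed.
Let ifs : is_ideal fs. Proof. exact: ideal_mul_ideal. Qed.
Let irfs : is_ideal rfs. Proof. exact: ideal_mul_ideal. Qed.
Let zrfs : zmod_subgroup rfs. Proof. by case: irfs. Qed.
Let fE x : f ('E x - 1). Proof. exact: relative_ideal_elt. Qed.

Let derived_rf x : derived_subgroup R x -> rf ('E x - 1).
Proof.
apply: (commutator_subgroup_min (P := ideal_subgroup rf)); first exact: (ideal_subgroup_subgroup irf).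
move=> u v Ru Rv; apply: (ideal_subgroup_comm irf).
  exact: (mem_ideal_mul (relative_ideal_elt Ru) (fE v)).
exact: (mem_ideal_mul (relative_ideal_elt Rv) (fE u)).
Qed.

Let derived_fs x : derived_subgroup S x -> fs ('E x - 1).
Proof.
apply: (commutator_subgroup_min (P := ideal_subgroup fs)); first exact: (ideal_subgroup_subgroup ifs).
move=> u v Su Sv; apply: (ideal_subgroup_comm ifs).
  exact: (mem_ideal_mul (fE u) (relative_ideal_elt Sv)).
exact: (mem_ideal_mul (fE v) (relative_ideal_elt Su)).
Qed.

Let rf_s x y : derived_subgroup R x -> S y -> rfs (('E x - 1) * ('E y - 1)).
Proof. by move=> /derived_rf rfx Sy; exact: (mem_ideal_mul rfx (relative_ideal_elt Sy)). Qed.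

Let r_fs x y : R x -> derived_subgroup S y -> rfs (('E x - 1) * ('E y - 1)).
Proof. by move=> Rx /derived_fs fsy; exact: (ideal_mulA (relative_ideal_elt Rx) fsy). Qed.

(* Left multiplication by elements of R is trivial on r modulo rf, so the unit factor of
   [group_elt_comm] disappears. *)
Let comm_mod x y : (R `&` S) x -> (R `&` S) y -> rfs (('E x - 1) * ('E y - 1)) ->
  rfs ('E [~ x, y]%g - 1 + ('E y - 1) * ('E x - 1)).
Proof.
move=> [Rx Sx] [Ry Sy] xy; rewrite group_elt_comm mulrBr -addrA.
have [_ lrfs _] := irfs; apply: (zsubD zrfs); first exact: lrfs.
set k := (_ * _)%g.
have -> : - ('E k * (('E y - 1) * ('E x - 1))) + ('E y - 1) * ('E x - 1) =
    - (('E k - 1) * ('E y - 1) * ('E x - 1)).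
  by rewrite -[in RHS]mulrA (mulrBl _ ('E k)) mul1r opprB addrC.
apply: (zsubN zrfs).
have Rk : R k by apply: (subgM sR); exact: (subgV sR).
exact: (mem_ideal_mul (mem_ideal_mul (relative_ideal_elt Rk) (fE y)) (relative_ideal_elt Sx)).
Qed.

(** Modulo rfs, [x1, y] - 1 is -(y - 1)(x1 - 1) and [x, y2] - 1 is -(y2 - 1)(x - 1). Since x1 - 1 is
    m(x - 1) modulo fs and y2 - 1 is m(y - 1) modulo rf, both equal -m(y - 1)(x - 1). *)
Lemma rfs_W : W R S `<=` ideal_subgroup rfs.
Proof.
apply: generated_min; first exact: (ideal_subgroup_subgroup irfs).
move=> _ [x [y [x1 [x2 [y1 [y2 [m [_ [Dx Dy] [xm ym] [[R'x1 Sx1] [R'y1 Sy1] [Rx2 S'x2] [Ry2 S'y2]] ->]]]]]]]].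
have [[Rx Sx] [Ry Sy]] := (Dx, Dy).
have Rx1 := derived_sub sR R'x1; have Ry1 := derived_sub sR R'y1.
have Sx2 := derived_sub sS S'x2; have Sy2 := derived_sub sS S'y2.
have [_ _ rrfs] := irfs.
have c1 : rfs ('E [~ x1, y]%g - 1 + ('E y - 1) * ('E x1 - 1)).
  exact: (comm_mod (conj Rx1 Sx1) Dy (rf_s R'x1 Sy)).
have c2 : rfs ('E [~ x, y2]%g - 1 + ('E y2 - 1) * ('E x - 1)).
  exact: (comm_mod Dx (conj Ry2 Sy2) (r_fs Rx S'y2)).
have px : fs ('E x1 - 1 - ('E x - 1) *+ m).
  have zfs : zmod_subgroup fs by case: ifs.
  have -> : 'E x1 - 1 - ('E x - 1) *+ m =
    ('E x1 - 1) + ('E x2 - 1) - ('E x - 1) *+ m - ('E x2 - 1).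
    by rewrite [RHS]addrAC addrK.
  apply: (zsubB zfs); last exact: derived_fs.
  apply: (power_mod ifs _ _ xm) => [n|].
    exact: (mem_ideal_mul (fE x) (relative_ideal_elt (subgX sS n Sx))).
  exact: (mem_ideal_mul (fE x1) (relative_ideal_elt Sx2)).
have py : rf ('E y2 - 1 - ('E y - 1) *+ m).
  have zrf : zmod_subgroup rf by case: irf.
  have -> : 'E y2 - 1 - ('E y - 1) *+ m =
    ('E y1 - 1) + ('E y2 - 1) - ('E y - 1) *+ m - ('E y1 - 1).
    by rewrite [RHS]addrAC [in RHS](addrC ('E y1 - 1)) addrK.
  apply: (zsubB zrf); last exact: derived_rf.
  apply: (power_mod irf _ _ ym) => [n|].
    exact: (mem_ideal_mul (relative_ideal_elt Ry) (fE _)).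
  exact: (mem_ideal_mul (relative_ideal_elt Ry1) (fE y2)).
have qx := ideal_mulA (relative_ideal_elt Ry) px.
have qy := mem_ideal_mul py (relative_ideal_elt Sx).
rewrite [('E y - 1) * (_ - _ *+ m)]mulrBr mulrnAr in qx.
rewrite [(_ - _ *+ m) * ('E x - 1)]mulrBl mulrnAl in qy.
have E12 : rfs ('E [~ x1, y]%g - 'E [~ x, y2]%g).
  have := zsubB zrfs (zsubB zrfs c1 qx) (zsubB zrfs c2 qy).
  have cancel (a u p : group_ring F) : a + u - (u - p) = a + p.
    by rewrite opprB addrACA subrr addr0.
  rewrite (cancel _ (('E y - 1) * ('E x1 - 1))) (cancel _ (('E y2 - 1) * ('E x - 1))).
  by rewrite opprD addrACA subrr addr0 opprB addrA subrK.
rewrite /ideal_subgroup /=.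
have -> : 'E ([~ x1, y] * [~ x, y2]^-1)%g - 1 =
    ('E [~ x1, y]%g - 'E [~ x, y2]%g) * 'E ([~ x, y2]^-1)%g.
  by rewrite mulrBl group_eltVK group_eltM.
exact: rrfs.
Qed.

Lemma generators_sub_rfs : product_set (product_set (product_set
    (commutator_subgroup (derived_subgroup R `&` derived_subgroup S) (R `&` S))
    (commutator_subgroup (derived_subgroup R `&` S) (derived_subgroup R `&` S)))
    (commutator_subgroup (R `&` derived_subgroup S) (R `&` derived_subgroup S)))
    (W R S) `<=` ideal_subgroup rfs.
Proof.
have sT := ideal_subgroup_subgroup irfs.
move=> _ [_ [_ [a Pa [b Pb <-]] [c Pc <-]] [d Wd <-]].
apply: (subgM sT); last exact: rfs_W.
apply: (subgM sT); [apply: (subgM sT)|].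
- move: a Pa; apply: commutator_subgroup_min => // x y [R'x S'x] [Ry Sy].
  by apply: (ideal_subgroup_comm irfs); [exact: (rf_s R'x Sy)|exact: (r_fs Ry S'x)].
- move: b Pb; apply: commutator_subgroup_min => // x y [R'x Sx] [R'y Sy].
  by apply: (ideal_subgroup_comm irfs); [exact: (rf_s R'x Sy)|exact: (rf_s R'y Sx)].
- move: c Pc; apply: commutator_subgroup_min => // x y [Rx S'x] [Ry S'y].
  by apply: (ideal_subgroup_comm irfs); [exact: (r_fs Rx S'y)|exact: (r_fs Ry S'x)].
Qed.

End RFS.

End DimensionSubgroup.

(** * The subgroup determined by rfs *)

(** As [X] contains [B, B], it is normalised by [B], hence by [Y]. The inclusions returned allow the
    product to be iterated. *)
Lemma product_subgroup (F : groupType) (B X Y : set F) :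
  is_subgroup B -> is_subgroup X -> is_subgroup Y -> X `<=` B -> Y `<=` B ->
  (forall x y, B x -> B y -> X [~ x, y]%g) ->
  [/\ is_subgroup (product_set X Y), product_set X Y `<=` B,
      X `<=` product_set X Y & Y `<=` product_set X Y].
Proof.
move=> sB sX sY XB YB BX.
have swap x y : X x -> B y -> X (y * x * y^-1)%g.
  move=> Xx By; have -> : (y * x * y^-1 = [~ y^-1, x^-1] * x)%g by rewrite !cgnorm.
  by apply: (subgM sX) => //; apply: BX; [exact: (subgV sB)|apply: (subgV sB); exact: XB].
split; first split.
- by exists 1%g; [exact: subg1|exists 1%g; [exact: subg1|rewrite mulg1]].
- move=> _ _ [x Xx [y Yy <-]] [x' Xx' [y' Yy' <-]].
  exists (x * (y * x' * y^-1))%g; first by apply: (subgM sX) => //; apply: swap => //; apply: YB.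
  by exists (y * y')%g; [exact: subgM|rewrite !cgnorm].
- move=> _ [x Xx [y Yy <-]].
  exists (y^-1 * x^-1 * (y^-1)^-1)%g.
    by apply: swap; [exact: subgV|apply: YB; exact: subgV].
  by exists (y^-1)%g; [exact: subgV|rewrite !cgnorm].
- by move=> _ [x Xx [y Yy <-]]; apply: (subgM sB); [exact: XB|exact: YB].
- by move=> x Xx; exists x => //; exists 1%g; [exact: subg1|rewrite mulg1].
- by move=> y Yy; exists 1%g; [exact: subg1|exists y => //; rewrite mul1g].
Qed.

Lemma hom_on_derived (F : groupType) (N : zmodType) (R : set F) (a : F -> N) x :
  is_subgroup R -> hom_on R a -> derived_subgroup R x -> a x = 0.
Proof.
move=> sR aR R'x; suff [] : R x /\ a x = 0 by [].
move: x R'x; apply: (commutator_subgroup_min (P := [set x | R x /\ a x = 0])).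
  split=> [|x y [Rx ax] [Ry ay]|x [Rx ax]] /=.
  - by split; [exact: subg1|exact: (hom_on1 sR aR)].
  - by split; [exact: subgM|rewrite aR // ax ay addr0].
  - by split; [exact: subgV|rewrite (hom_onV sR aR) // ax oppr0].
move=> x y Rx Ry; split; first exact: subgR.
have := aR (y * x)%g [~ x, y]%g (subgM sR Ry Rx) (subgR sR Rx Ry).
by rewrite -commgC (aR x y) // (aR y x) // addrC -[LHS]addr0 => /addrI.
Qed.

Section RFSSubgroup.
Variables (F : groupType) (R S : set F).
Hypotheses (freeF : is_free_group F) (nR : is_normal_subgroup R) (nS : is_normal_subgroup S).
Let sR : is_subgroup R := nR.1.
Let sS : is_subgroup S := nS.1.
Let D := R `&` S.
Let D' := derived_subgroup D.
Let R' := derived_subgroup R.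
Let S' := derived_subgroup S.
Let sD : is_subgroup D. Proof. exact: is_subgroupI. Qed.
Let sD' : is_subgroup D'. Proof. exact: commutator_subgroup_subgroup. Qed.
Let sR' : is_subgroup R'. Proof. exact: commutator_subgroup_subgroup. Qed.
Let D'R' : D' `<=` R'. Proof. by apply: commutator_subgroupS => x []. Qed.
Let D'S' : D' `<=` S'. Proof. by apply: commutator_subgroupS => x []. Qed.
Let D'D : D' `<=` D. Proof. exact: derived_sub. Qed.
Let R'R : R' `<=` R. Proof. exact: derived_sub. Qed.
Let S'S : S' `<=` S. Proof. exact: derived_sub. Qed.
Let rfs := ideal_mul (ideal_mul (relative_ideal R) (relative_ideal [set: F])) (relative_ideal S).

(** First the indicators of [R] and [S] put w into D, then the functional of [rs_functional] with
    values in D/D' shows that its class there is zero. *)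
Lemma rfs_sub_derived w : ideal_subgroup rfs w -> D' w.
Proof.
move=> Tw.
(* The indicator of a set invariant under [R] on the left or [S] on the right has zero second
   difference. *)
have const G : (forall x u, R x -> G (x * u)%g <-> G u) \/
    (forall u y, S y -> G (u * y)%g <-> G u) -> G w <-> G 1%g.
  move=> GE; pose Phi (u : F) : int := `[< G u >]%:R.
  have : Phi w = Phi 1%g.
    apply: (rfs_const nR nS (Theta := fun _ _ => 0)) Tw => x u y Rx Sy; rewrite /Phi.
    case: GE => GE.
      by rewrite -mulgA !(asbool_equiv_eq (GE x _ Rx)) subrr.
    by rewrite !(asbool_equiv_eq (GE _ y Sy)) !subrr.
  rewrite /Phi; case: asboolP; case: asboolP => //; by split.
have Rw : R w.
  by apply/(const R); [left=> x u; apply: (subgMl sR)|exact: subg1].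
have Sw : S w.
  by apply/(const S); [right=> u y; apply: (subgMr sS)|exact: subg1].
have [A [cA [cAM cA0 _]]] := abelian_quotient sD sD' (fun x y Dx Dy => commutator_subgroupR Dx Dy).
have [Phi [PhiE PhiD]] := rs_functional sR sS cAM.
by apply/cA0 => //; rewrite -PhiD // (rfs_const nR nS PhiE Tw) subrr.
Qed.

Variable N : set F.
Hypotheses (sN : is_subgroup N)
  (N1 : forall x y, R' x -> S' x -> D y -> N [~ x, y]%g)
  (N2 : forall x y, R' x -> S x -> R' y -> S y -> N [~ x, y]%g)
  (N3 : forall x y, R x -> S' x -> R y -> S' y -> N [~ x, y]%g)
  (N4 : W R S `<=` N).

(** [N] stands for the product of the four factors and enters only through the commutators it
    contains. The commutator map induces an alternating form on D/D' with values in D'/N, to which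
    [alternating_vanish] is applied. *)
Lemma rfs_sub w : ideal_subgroup rfs w -> N w.
Proof.
move=> Tw; have D'w := rfs_sub_derived Tw.
have D'N x y : D' x -> D y -> N [~ x, y]%g.
  by move=> D'x Dy; apply: N1 => //; [exact: D'R'|exact: D'S'].
have [E [cE [cEM cE0 _]]] := abelian_quotient sD' sN (fun x y Dx Dy => D'N x y Dx (D'D Dy)).
have DD' x y : D x -> D y -> D' [~ x, y]%g by apply: commutator_subgroupR.
have [A [cA [cAM cA0 cAs]]] := abelian_quotient sD sD' DD'.
have [v vP] := boolp.choice cAs.
have vD a : D (v a) by case: (vP a).
have vK a : cA (v a) = a by case: (vP a).
pose w0 x y := cE [~ x, y]%g.
(* The correction term [[x, y], x'] lies in [D', D], hence in [N], so the commutator is bilinear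
   modulo [N]. *)
have w0M x x' y : D x -> D x' -> D y -> w0 (x * x')%g y = w0 x y + w0 x' y.
  move=> Dx Dx' Dy; rewrite /w0.
  have -> : [~ x * x', y]%g = ([~ x, y] * [~ [~ x, y], x'] * [~ x', y])%g by rewrite !cgnorm.
  have D1 := DD' _ _ Dx Dy; have D2 := DD' _ _ (D'D D1) Dx'.
  rewrite (cEM _ _ (subgM sD' D1 D2) (DD' _ _ Dx' Dy)) (cEM _ _ D1 D2).
  by rewrite [X in _ + X + _](cE0 _ D2).2 ?addr0 //; exact: (D'N _ _ D1 Dx').
have w0N x y : D x -> D y -> w0 x y = - w0 y x.
  move=> Dx Dy; apply/eqP; rewrite -addr_eq0 -(cEM _ _ (DD' _ _ Dx Dy) (DD' _ _ Dy Dx)).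
  by rewrite -[[~ y, x]%g]invgR mulgV; apply/eqP/cE0; [exact: (subg1 sD')|exact: (subg1 sN)].
have hom_w0 y : D y -> hom_on D (w0^~ y) by move=> Dy x x' Dx Dx'; apply: w0M.
have w0D' d y : D' d -> D y -> w0 d y = 0.
  by move=> D'd Dy; apply/cE0; [apply: DD' => //; exact: D'D|exact: D'N].
have vE x : D x -> exists2 d, D' d & v (cA x) = (x * d)%g.
  move=> Dx; have DV := subgV sD Dx; have Dd := subgM sD DV (vD (cA x)).
  exists (x^-1 * v (cA x))%g; last by rewrite mulVKg.
  by apply/(cA0 _ Dd); rewrite (cAM _ _ DV (vD _)) vK (hom_onV sD cAM Dx) addNr.
have factor (M : zmodType) (h : F -> M) x : hom_on D h -> (forall d, D' d -> h d = 0) ->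
    D x -> h (v (cA x)) = h x.
  move=> hD h0 Dx; have [d D'd ->] := vE x Dx.
  by rewrite (hD _ _ Dx (D'D D'd)) (h0 d) // addr0.
(* The form is computed on chosen lifts [v]; since [w0] vanishes on D' in each variable, any other
   lifts give the same value. *)
pose om a b := w0 (v a) (v b).
have omE x y : D x -> D y -> om (cA x) (cA y) = w0 x y.
  move=> Dx Dy; rewrite /om (factor _ (w0^~ (v (cA y))) x (hom_w0 _ (vD _))) //; last first.
    by move=> d D'd; exact: (w0D' _ _ D'd (vD _)).
  rewrite (w0N _ _ Dx (vD _)) (factor _ (w0^~ x) y (hom_w0 _ Dx)) ?(w0N _ _ Dx Dy) //.
  by move=> d D'd; exact: (w0D' _ _ D'd Dx).
have cAi a b : exists x y, [/\ D x, D y, a = cA x & b = cA y] by exists (v a), (v b).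
(* For [G] one of [R], [S]: the image of D \cap G' in D/D', and the functionals induced by
   homomorphisms from [G] to Z. Both are independent of the lift because D' lies in G'. *)
pose K (G : set F) : set A := [set a | derived_subgroup G (v a)].
pose FG (G : set F) : set (A -> int) := [set f | exists2 al : F -> int, hom_on G al & f = al \o v].
have KE G x : is_subgroup G -> D `<=` G -> D x -> K G (cA x) <-> derived_subgroup G x.
  move=> sG DG Dx; have [d D'd E1] := vE x Dx; rewrite /K /= E1.
  apply: (subgMr (commutator_subgroup_subgroup G G)).
  exact: (commutator_subgroupS DG DG D'd).
have FGE G (al : F -> int) x : is_subgroup G -> D `<=` G -> hom_on G al -> D x -> al (v (cA x)) = al x.
  move=> sG DG hal Dx; apply: factor => // [a b Da Db|d D'd]; first by apply: hal; apply: DG.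
  by apply: (hom_on_derived sG hal); apply: commutator_subgroupS D'd.
have FGD G : is_subgroup G -> D `<=` G -> forall f, FG G f -> {morph f : x y / x + y}.
  move=> sG DG f [al hal ->] a b /=; have [x [y [Dx Dy -> ->]]] := cAi a b.
  by rewrite -cAM // !(FGE G) //; [apply: hal; apply: DG|exact: subgM].
have KFG G : is_subgroup G -> D `<=` G -> forall a, K G a <-> forall f, FG G f -> f a = 0.
  move=> sG DG a; split=> [Ka f [al hal ->]|fa] /=; first exact: (hom_on_derived sG hal).
  apply: derived_separated => // [|al hal]; first exact: DG.
  by apply: (fa (al \o v)); exists al.
have DR : D `<=` R by move=> x [].
have DS : D `<=` S by move=> x [].
have [n [a [b [Dab wE]]]] := derivedP D'w.
have DabR i : D' [~ a i, b i]%g by apply: DD'; case: (Dab i).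
have prodE (M : zmodType) (h : F -> M) : hom_on D' h ->
    h w = \sum_i h [~ a i, b i]%g.
  move=> hD'; rewrite wE.
  suff /(_ (index_enum _))[] : forall r : seq 'I_n, D' (\prod_(i <- r) [~ a i, b i])%g /\
    h (\prod_(i <- r) [~ a i, b i])%g = \sum_(i <- r) h [~ a i, b i]%g by [].
  elim=> [|i r [IH1 IH2]]; rewrite ?big_nil ?big_cons.
    by split; [exact: (subg1 sD')|exact: (hom_on1 sD' hD')].
  by split; [exact: (subgM sD' (DabR i) IH1)|rewrite (hD' _ _ (DabR i) IH1) IH2].
suff : cE w = 0 by move/cE0; apply.
rewrite (prodE _ _ cEM).
under eq_bigr => i _ do rewrite -[cE _]/(w0 _ _) -(omE _ _ (Dab i).1 (Dab i).2).
apply: (@alternating_vanish A E (FG R) (FG S) (FGD R sR DR) (FGD S sS DS) (K R) (K S)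
  (KFG R sR DR) (KFG S sS DS) om).
- move=> c x y; have [s [t [Ds Dt -> ->]]] := cAi x y; have [u [_ [Du _ -> _]]] := cAi c c.
  by rewrite -cAM // !omE ?w0M //; exact: subgM.
- move=> c x y; have [s [t [Ds Dt -> ->]]] := cAi x y; have [u [_ [Du _ -> _]]] := cAi c c.
  rewrite -cAM // !omE //; last exact: subgM.
  by rewrite w0N ?w0M ?[w0 s u]w0N ?[w0 t u]w0N ?opprD ?opprK //; exact: subgM.
- by move=> c; rewrite /om /w0 commgg; apply/cE0; exact: subg1.
- move=> x y; have [s [t [Ds Dt -> ->]]] := cAi x y.
  move=> /(KE R _ sR DR Ds) R's /(KE S _ sS DS Ds) S's; rewrite omE //; apply/cE0; [exact: DD'|].
  exact: N1.
- move=> x y; have [s [t [Ds Dt -> ->]]] := cAi x y.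
  move=> /(KE R _ sR DR Ds) R's /(KE R _ sR DR Dt) R't; rewrite omE //; apply/cE0; [exact: DD'|].
  by apply: N2 => //; apply: DS.
- move=> x y; have [s [t [Ds Dt -> ->]]] := cAi x y.
  move=> /(KE S _ sS DS Ds) S's /(KE S _ sS DS Dt) S't; rewrite omE //; apply/cE0; [exact: DD'|].
  by apply: N3 => //; apply: DR.
- move=> m x y x1 x2 y1 y2 m2.
  have [s [t [Ds Dt -> ->]]] := cAi x y.
  have [s1 [t1 [Ds1 Dt1 -> ->]]] := cAi x1 y1.
  move=> /(KE R _ sR DR Ds1) R's1 Kx2 /(KE R _ sR DR Dt1) R't1 Ky2 sm tm.
  have cAX u : D u -> cA (u ^+ m)%g = cA u *+ m.
    move=> Du; elim: m {m2 sm tm} => [|m IH]; first by rewrite expg0 (hom_on1 sD cAM).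
    by rewrite expgS (cAM _ _ Du (subgX sD m Du)) IH mulrS.
  (* The second summand is lifted to u1^-1 u^m, so the decomposition of the m-th power holds in [F]
     itself, as the generators of [W] require. *)
  have quot u u1 z : D u -> D u1 -> cA u *+ m = cA u1 + z -> z = cA (u1^-1 * u ^+ m)%g.
    move=> Du Du1 E1; rewrite (cAM _ _ (subgV sD Du1) (subgX sD m Du)) (hom_onV sD cAM Du1).
    by rewrite cAX // E1 addKr.
  have Ds2 := subgM sD (subgV sD Ds1) (subgX sD m Ds).
  have Dt2 := subgM sD (subgV sD Dt1) (subgX sD m Dt).
  move: Kx2 Ky2; rewrite (quot _ _ _ Ds Ds1 sm) (quot _ _ _ Dt Dt1 tm).
  move=> /(KE S _ sS DS Ds2) S's2 /(KE S _ sS DS Dt2) S't2; rewrite !omE //.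
  apply/eqP; rewrite -subr_eq0 /w0 -(hom_onV sD' cEM (DD' _ _ Ds Dt2)).
  rewrite -(cEM _ _ (DD' _ _ Ds1 Dt) (subgV sD' (DD' _ _ Ds Dt2))).
  apply/eqP/cE0; first exact: (subgM sD' (DD' _ _ Ds1 Dt) (subgV sD' (DD' _ _ Ds Dt2))).
  apply: N4; apply: sub_generated.
  exists s, t, s1, (s1^-1 * s ^+ m)%g, t1, (t1^-1 * t ^+ m)%g, m.
  split=> //; first by rewrite !mulVKg.
  by split; split=> //; [exact: DS|exact: DS|exact: DR|exact: DR].
(* On D' the function [h] is a homomorphism, because [al] vanishes there, and its value at [x, y] is
   al(x) be(y) - al(y) be(x). As w lies in 1 + rfs, h(w) = 0, which is the required relation. *)
- move=> f g [al hal ->] [be hbe ->] /=.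
  have [Phi PhiE] := rfs_functional freeF sR sS hal hbe.
  have Phiw := rfs_const nR nS PhiE Tw.
  pose h u := Phi u - Phi 1%g.
  have hM x y : D x -> D y -> h (x * y)%g = h x + h y + al x * be y.
    move=> [Rx _] [_ Sy]; rewrite -(PhiE x 1%g y Rx Sy) !mulg1 mul1g /h; ring.
  have hD' : hom_on D' h.
    move=> x y D'x D'y; rewrite hM ?(hom_on_derived sR hal (D'R' D'x)) ?mul0r ?addr0 //; exact: D'D.
  have hR x y : D x -> D y -> h [~ x, y]%g = al x * be y - al y * be x.
    move=> Dx Dy; have Dc := DD' _ _ Dx Dy.
    have := hM (y * x)%g [~ x, y]%g (subgM sD Dy Dx) (D'D Dc).
    rewrite -commgC (hom_on_derived sS hbe (D'S' Dc)) (hM x y Dx Dy) (hM y x Dy Dx) mulr0 => E0; lia.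
  rewrite -[RHS](_ : h w = 0); last by rewrite /h Phiw subrr.
  rewrite (prodE _ _ hD'); apply: eq_bigr => i _; have [Da Db] := Dab i.
  rewrite !(FGE R al _ sR DR hal Da, FGE R al _ sR DR hal Db).
  by rewrite !(FGE S be _ sS DS hbe Da, FGE S be _ sS DS hbe Db) (hR _ _ Da Db).
Qed.
End RFSSubgroup.

Theorem theorem2p2 (F : groupType) (R S : set F)
    (freeF : is_free_group F)
    (nR : is_normal_subgroup R) (nS : is_normal_subgroup S) :
  let r := relative_ideal R in
  let f := relative_ideal [set: F] in
  let s := relative_ideal S in
  let R' := derived_subgroup R in
  let S' := derived_subgroup S in
  ideal_subgroup (ideal_mul (ideal_mul r f) s) =
  product_set (product_set (product_set
    (commutator_subgroup (R' `&` S') (R `&` S))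
    (commutator_subgroup (R' `&` S) (R' `&` S)))
    (commutator_subgroup (R `&` S') (R `&` S')))
    (W R S).
Proof.
move=> r f s R' S'; apply/seteqP; split; last exact: generators_sub_rfs.
have [sR sS] : is_subgroup R /\ is_subgroup S by split; [exact: nR.1|exact: nS.1].
set X1 := commutator_subgroup _ (R `&` S).
set X2 := commutator_subgroup (R' `&` S) _.
set X3 := commutator_subgroup (R `&` S') _.
(* All four factors lie in D', and the first contains [D', D']; hence the successive product sets
   are subgroups. *)
pose B := derived_subgroup (R `&` S).
have sB : is_subgroup B by apply: commutator_subgroup_subgroup.
have BR' : B `<=` R' by apply: commutator_subgroupS => x [].
have BS' : B `<=` S' by apply: commutator_subgroupS => x [].
have BD : B `<=` R `&` S by apply: derived_sub; apply: is_subgroupI.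
have R'R : R' `<=` R by apply: derived_sub.
have S'S : S' `<=` S by apply: derived_sub.
have X1B : X1 `<=` B by apply: commutator_subgroupS => // x [/R'R ? /S'S].
have X2B : X2 `<=` B by apply: commutator_subgroupS => x [/R'R].
have X3B : X3 `<=` B by apply: commutator_subgroupS => x [? /S'S].
have WB : W R S `<=` B.
  apply: generated_min => // _ [x [y [x1 [x2 [y1 [y2 [m [_ [Dx Dy] _ [[R'x1 Sx1] _ _ [Ry2 S'y2]] ->]]]]]]]].
  apply: (subgM sB); last apply: (subgV sB).
    by apply: commutator_subgroupR => //; split=> //; exact: R'R.
  by apply: commutator_subgroupR => //; split=> //; exact: S'S.
have BX1 x y : B x -> B y -> X1 [~ x, y]%g.
  move=> Bx By; apply: commutator_subgroupR; last exact: BD.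
  by split; [exact: BR'|exact: BS'].
have sX (A A' : set F) : is_subgroup (commutator_subgroup A A') by apply: commutator_subgroup_subgroup.
have [s12 B12 sub1 sub2] := product_subgroup sB (sX _ _) (sX _ _) X1B X2B BX1.
have [s123 B123 sub12 sub3] := product_subgroup sB s12 (sX _ _) B12 X3B
  (fun x y Bx By => sub1 _ (BX1 x y Bx By)).
have [sN _ sub123 subW] := product_subgroup sB s123 (generated_subgroup _) B123 WB
  (fun x y Bx By => sub12 _ (sub1 _ (BX1 x y Bx By))).
move=> w; apply: rfs_sub => //.
- by move=> x y ? ? ?; apply/sub123/sub12/sub1; apply: commutator_subgroupR.
- by move=> x y R'x Sx R'y Sy; apply/sub123/sub12/sub2; exact: commutator_subgroupR (conj _ _) (conj _ _).
- by move=> x y Rx S'x Ry S'y; apply/sub123/sub3; exact: commutator_subgroupR (conj _ _) (conj _ _).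
Qed.
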